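(* If $A$ is a superhigh computably enumerable set, then for any $\Delta^0_2$ DNR set $X$ one has $A\oplus X\geq_T\emptyset'$.
   Context: $A$ is superhigh if $\emptyset''\le_{tt}A'$. A set $X$ is DNR (has DNR degree) if it computes a function $g$ with $g(e)\ne\varphi_e(e)$ whenever $\varphi_e(e)$ is defined. *)

(* Defs.v *)
From Stdlib Require Import Arith Cantor.

Notation natset := (nat -> Prop).

Notation "⟨ x , y ⟩" := (Cantor.to_nat (x, y)) (at level 0, format "⟨ x ,  y ⟩").

Definition unpair_l (n : nat) : nat := fst (Cantor.of_nat n).
Definition unpair_r (n : nat) : nat := snd (Cantor.of_nat n).

(* Kleene's mu-recursive functions with one extra basic function, the
   characteristic function of the oracle.  All functions are unary; several
   arguments are passed through the Cantor pairing.  The identity is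
   [Pair Left Right]. *)
Inductive code : Type :=
| Zero | Succ | Left | Right | Oracle
| Pair (f g : code)
| Comp (f g : code)
| Prec (f g : code)
| Mu (f : code).

Fixpoint prec_graph (F G : nat -> nat -> Prop) (a n y : nat) : Prop :=
  match n with
  | 0 => F a y
  | S m => exists r, prec_graph F G a m r /\ G ⟨a, ⟨m, r⟩⟩ y
  end.

(* [eval A c x y]: the program [c] with oracle [A] halts on [x] with output [y]. *)
Fixpoint eval (A : natset) (c : code) (x y : nat) : Prop :=
  match c with
  | Zero => y = 0
  | Succ => y = S x
  | Left => y = unpair_l x
  | Right => y = unpair_r x
  | Oracle => (A x /\ y = 1) \/ (~ A x /\ y = 0)
  | Pair f g => exists u v, eval A f x u /\ eval A g x v /\ y = ⟨u, v⟩
  | Comp f g => exists z, eval A g x z /\ eval A f z y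
  | Prec f g => prec_graph (eval A f) (eval A g) (unpair_l x) (unpair_r x) y
  | Mu f => eval A f ⟨x, y⟩ 0 /\
            forall z, z < y -> exists v, eval A f ⟨x, z⟩ (S v)
  end.

Fixpoint encode (c : code) : nat :=
  match c with
  | Zero => ⟨0, 0⟩
  | Succ => ⟨1, 0⟩
  | Left => ⟨2, 0⟩
  | Right => ⟨3, 0⟩
  | Oracle => ⟨4, 0⟩
  | Pair f g => ⟨5, ⟨encode f, encode g⟩⟩
  | Comp f g => ⟨6, ⟨encode f, encode g⟩⟩
  | Prec f g => ⟨7, ⟨encode f, encode g⟩⟩
  | Mu f => ⟨8, encode f⟩
  end.

(* [phi A e x y] is "Phi_e^A(x) converges with value y"; a number that codes no
   program is an index of the nowhere defined function. *)
Definition phi (A : natset) (e x y : nat) : Prop :=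
  exists c, encode c = e /\ eval A c x y.

Definition empty : natset := fun _ => False.

Definition computes_fun (A : natset) (f : nat -> nat) : Prop :=
  exists e, forall n, phi A e n (f n).

Definition turing_le (B A : natset) : Prop :=
  exists e, forall n, (B n -> phi A e n 1) /\ (~ B n -> phi A e n 0).

Definition computable_fun (f : nat -> nat) : Prop := computes_fun empty f.

Definition computable_set (B : natset) : Prop := turing_le B empty.

Definition ce (B : natset) : Prop :=
  exists e, forall n, B n <-> exists y, phi empty e n y.

Definition jump (A : natset) : natset := fun e => exists y, phi A e e y.

Definition join (A B : natset) : natset := fun n =>
  (exists m, n = 2 * m /\ A m) \/ (exists m, n = 2 * m + 1 /\ B m).

(* Truth-table conditions: Boolean combinations of the atoms "k belongs to
   the oracle". *)
Inductive bform : Type :=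
| Atom (k : nat)
| Not (p : bform)
| And (p q : bform)
| Or (p q : bform).

Fixpoint sat (A : natset) (p : bform) : Prop :=
  match p with
  | Atom k => A k
  | Not p => ~ sat A p
  | And p q => sat A p /\ sat A q
  | Or p q => sat A p \/ sat A q
  end.

Fixpoint encode_bform (p : bform) : nat :=
  match p with
  | Atom k => ⟨0, k⟩
  | Not p => ⟨1, encode_bform p⟩
  | And p q => ⟨2, ⟨encode_bform p, encode_bform q⟩⟩
  | Or p q => ⟨3, ⟨encode_bform p, encode_bform q⟩⟩
  end.

Definition tt_le (B A : natset) : Prop :=
  exists t : nat -> bform,
    computable_fun (fun n => encode_bform (t n)) /\
    forall n, B n <-> sat A (t n).

Definition superhigh (A : natset) : Prop := tt_le (jump (jump empty)) (jump A).

Definition DNR (X : natset) : Prop :=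
  exists g : nat -> nat,
    computes_fun X g /\ forall e y, phi empty e e y -> g e <> y.

Definition Sigma02 (X : natset) : Prop :=
  exists R : natset, computable_set R /\
    forall n, X n <-> exists a, forall b, R ⟨n, ⟨a, b⟩⟩.

Definition Pi02 (X : natset) : Prop :=
  exists R : natset, computable_set R /\
    forall n, X n <-> forall a, exists b, R ⟨n, ⟨a, b⟩⟩.

Definition Delta02 (X : natset) : Prop := Sigma02 X /\ Pi02 X.

Lemma pair_inj a b c d : ⟨a, b⟩ = ⟨c, d⟩ -> a = c /\ b = d.
Proof. intros H. apply Cantor.to_nat_inj in H. now inversion H. Qed.

Lemma encode_inj c d : encode c = encode d -> c = d.
Proof.
  revert d; induction c; intros []; cbn [encode]; intros H;
    apply pair_inj in H; destruct H as [H1 H2]; try discriminate; auto;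
    try (apply pair_inj in H2; destruct H2); f_equal; auto.
Qed.

Lemma encode_bform_inj p q : encode_bform p = encode_bform q -> p = q.
Proof.
  revert q; induction p; intros []; cbn [encode_bform]; intros H;
    apply pair_inj in H; destruct H as [H1 H2]; try discriminate;
    try (apply pair_inj in H2; destruct H2); f_equal; auto.
Qed.

Lemma eval_functional A c x y z : eval A c x y -> eval A c x z -> y = z.
Proof.
  revert x y z; induction c as [| | | | |f IHf g IHg|f IHf g IHg|f IHf g IHg|f IHf];
    cbn [eval]; intros x y z.
  1-4: congruence.
  - intros [[? ->]|[? ->]] [[? ->]|[? ->]]; tauto.
  - intros (u & v & H1 & H2 & ->) (u' & v' & H3 & H4 & ->).
    now rewrite (IHf _ _ _ H1 H3), (IHg _ _ _ H2 H4).
  - intros (u & H1 & H2) (v & H3 & H4).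
    rewrite (IHg _ _ _ H1 H3) in H2. eauto.
  - generalize (unpair_l x) as a, (unpair_r x) as n. intros a n; revert y z.
    induction n as [|n IHn]; cbn [prec_graph]; intros y z; [eauto|].
    intros (r & H1 & H2) (s & H3 & H4).
    rewrite (IHn _ _ H1 H3) in H2. eauto.
  - intros [H1 H2] [H3 H4].
    destruct (Nat.lt_trichotomy y z) as [L|[L|L]]; auto.
    + destruct (H4 _ L) as [v Hv]. discriminate (IHf _ _ _ H1 Hv).
    + destruct (H2 _ L) as [v Hv]. discriminate (IHf _ _ _ H3 Hv).
Qed.

Lemma phi_functional A e x y z : phi A e x y -> phi A e x z -> y = z.
Proof.
  intros (c & Hc & H1) (d & Hd & H2).
  assert (c = d) as -> by (apply encode_inj; congruence).
  exact (eval_functional _ _ _ _ _ H1 H2).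
Qed.

(* Main.v *)
From Stdlib Require Import Arith Lia Cantor Bool ClassicalEpsilon Classical.
Require Import Defs.

(** Let [g] be a DNR function computed by [X]; it is the limit of a computable [G t v].
    Let [U t] approximate the jump of the c.e. set [A] by looking only at what [A]
    enumerated by stage [t], cut off so that [U t] is correct at infinitely many true
    stages.  For each [n] we build a set of "pushed" stages and, by the recursion theorem,
    let a Pi_2 question about this construction ("are there infinitely many growth
    stages?") be answered, through superhighness, by a truth table on the jump of [A];
    evaluated on [U t] this gives a guess at stage [t].  A pushed stage stays valid as long
    as [A] does not change below its use.  Pushes alternate between the answers "finitely
    many" and "infinitely many", and a push of the second kind is wanted when the current
    values [G t] at certain points differ from those at the last push of the first kind;
    until it happens the construction grows.  Each alternation needs a new atom of the table
    in the jump, so the number of simultaneously valid pushes has a bound known in advance,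
    and we can reserve one diagonalization point for each of them.

    A permanently valid push [l] of the first kind with [G l = g] at the reserved points
    must exist, since otherwise the guess is wrong in the limit, and [A] and [X] recognize it.
    If [n] entered the halting problem after stage [l], the program at the point reserved for
    [l] would output [G l], that is the value of [g], against DNR.  Hence [n] is in the
    halting problem iff it has entered by stage [l]. *)

(** * Closure properties of computable functions *)

Arguments Cantor.to_nat : simpl never.
Arguments unpair_l : simpl never.
Arguments unpair_r : simpl never.

Lemma unpair_l_pair a b : unpair_l ⟨a, b⟩ = a.
Proof. unfold unpair_l. now rewrite Cantor.cancel_of_to. Qed.

Lemma unpair_r_pair a b : unpair_r ⟨a, b⟩ = b.
Proof. unfold unpair_r. now rewrite Cantor.cancel_of_to. Qed.

Lemma pair_unpair x : ⟨unpair_l x, unpair_r x⟩ = x.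
Proof.
  unfold unpair_l, unpair_r. rewrite <- surjective_pairing. apply Cantor.cancel_to_of.
Qed.

Lemma pair_ge a b : a + b <= ⟨a, b⟩.
Proof. pose proof (Cantor.to_nat_non_decreasing a b). lia. Qed.

Ltac unp := repeat first [rewrite unpair_l_pair | rewrite unpair_r_pair].
Tactic Notation "unp" "in" "*" :=
  repeat first [rewrite unpair_l_pair in * | rewrite unpair_r_pair in *].

(** Asks for a program rather than an index, so that closure properties are proved by writing
    codes. *)
Definition rec (O : natset) (f : nat -> nat) : Prop :=
  exists c, forall x, eval O c x (f x).

Definition recb (O : natset) (b : nat -> bool) : Prop :=
  rec O (fun x => Nat.b2n (b x)).

Definition rec2 (O : natset) (f : nat -> nat -> nat) : Prop :=
  rec O (fun z => f (unpair_l z) (unpair_r z)).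

Definition recb2 (O : natset) (b : nat -> nat -> bool) : Prop :=
  recb O (fun z => b (unpair_l z) (unpair_r z)).

Definition rec3 (O : natset) (f : nat -> nat -> nat -> nat) : Prop :=
  rec O (fun z => f (unpair_l z) (unpair_l (unpair_r z)) (unpair_r (unpair_r z))).

Definition recb3 (O : natset) (f : nat -> nat -> nat -> bool) : Prop :=
  recb O (fun z => f (unpair_l z) (unpair_l (unpair_r z)) (unpair_r (unpair_r z))).

Section Closure.

Context {O : natset}.

Lemma rec_ext f g : (forall x, f x = g x) -> rec O f -> rec O g.
Proof. intros E [c H]. exists c. intros x. rewrite <- E. apply H. Qed.

Lemma recb_ext b c : (forall x, b x = c x) -> recb O b -> recb O c.
Proof. intros E. apply rec_ext. intros x. now rewrite E. Qed.

Lemma rec_comp f g : rec O f -> rec O g -> rec O (fun x => f (g x)).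
Proof. intros [c H] [d K]. exists (Comp c d). intros x. exists (g x). auto. Qed.

Lemma rec_id : rec O (fun x => x).
Proof.
  exists (Pair Left Right). intros x. exists (unpair_l x), (unpair_r x).
  cbn. now rewrite pair_unpair.
Qed.

Lemma rec_S f : rec O f -> rec O (fun x => S (f x)).
Proof. apply rec_comp. now exists Succ. Qed.

Lemma rec_const k : rec O (fun _ => k).
Proof. induction k; [now exists Zero | now apply rec_S]. Qed.

Lemma rec_l f : rec O f -> rec O (fun x => unpair_l (f x)).
Proof. apply rec_comp. now exists Left. Qed.

Lemma rec_r f : rec O f -> rec O (fun x => unpair_r (f x)).
Proof. apply rec_comp. now exists Right. Qed.

Lemma rec_pair f g : rec O f -> rec O g -> rec O (fun x => ⟨f x, g x⟩).
Proof. intros [c H] [d K]. exists (Pair c d). intros x. exists (f x), (g x). auto. Qed.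

Lemma rec2_app f a b : rec2 O f -> rec O a -> rec O b -> rec O (fun x => f (a x) (b x)).
Proof.
  intros H Ha Hb. apply rec_ext with (f := fun x => (fun z => f (unpair_l z) (unpair_r z)) ⟨a x, b x⟩).
  - intros x. now unp.
  - apply (rec_comp _ _ H). now apply rec_pair.
Qed.

Lemma recb2_app f a b : recb2 O f -> rec O a -> rec O b -> recb O (fun x => f (a x) (b x)).
Proof. exact (rec2_app (fun x y => Nat.b2n (f x y)) a b). Qed.

Lemma rec3_app f a b c : rec3 O f -> rec O a -> rec O b -> rec O c ->
  rec O (fun x => f (a x) (b x) (c x)).
Proof.
  intros H Ha Hb Hc. apply rec_ext with (f := fun x => (fun z => f (unpair_l z)
    (unpair_l (unpair_r z)) (unpair_r (unpair_r z))) ⟨a x, ⟨b x, c x⟩⟩).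
  - intros x. now unp.
  - apply (rec_comp _ _ H). auto using rec_pair.
Qed.

Lemma recb3_app f a b c : recb3 O f -> rec O a -> rec O b -> rec O c ->
  recb O (fun x => f (a x) (b x) (c x)).
Proof. exact (rec3_app (fun x y z => Nat.b2n (f x y z)) a b c). Qed.

Lemma recb_comp b g : recb O b -> rec O g -> recb O (fun x => b (g x)).
Proof. exact (rec_comp (fun x => Nat.b2n (b x)) g). Qed.

(** [Prec] with the whole input [x] as parameter; the bounded operators and course-of-values
    recursion are brought to this form. *)
Lemma rec_rect (b n : nat -> nat) (s : nat -> nat -> nat -> nat) :
  rec O b -> rec O n -> rec3 O s ->
  rec O (fun x => nat_rect (fun _ => nat) (b x) (s x) (n x)).
Proof.
  intros [cb Hb] Hn [cs Hs].
  apply (rec_ext (fun x => (fun z => nat_rect (fun _ => nat) (b (unpair_l z))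
    (s (unpair_l z)) (unpair_r z)) ⟨x, n x⟩)).
  { intros x. now unp. }
  refine (rec_comp (fun z => nat_rect (fun _ => nat) (b (unpair_l z))
    (s (unpair_l z)) (unpair_r z)) _ _ (rec_pair _ _ rec_id Hn)).
  exists (Prec cb cs). intros x. cbn [eval].
  generalize (unpair_l x) as a. intros a. induction (unpair_r x) as [|m IH]; cbn; [apply Hb|].
  eexists. split; [apply IH|].
  set (r := nat_rect _ _ _ m). specialize (Hs ⟨a, ⟨m, r⟩⟩). now unp in *.
Qed.

Lemma recb_const k : recb O (fun _ => k).
Proof. exact (rec_const (Nat.b2n k)). Qed.

Lemma rec_if b f g : recb O b -> rec O f -> rec O g ->
  rec O (fun x => if b x then f x else g x).
Proof.
  intros Hb Hf Hg.
  (* A conditional is a recursion of length 0 or 1. The redex displays the step in the form [s x] of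
     [rec_rect]. *)
  apply rec_ext with (f := fun x => nat_rect (fun _ => nat) (g x) ((fun x _ _ => f x) x) (Nat.b2n (b x))).
  - intros x. now destruct (b x).
  - apply rec_rect; auto. apply (rec_comp f); auto using rec_l, rec_id.
Qed.

Lemma recb_if b f g : recb O b -> recb O f -> recb O g ->
  recb O (fun x => if b x then f x else g x).
Proof.
  intros Hb Hf Hg. eapply rec_ext; [|exact (rec_if b _ _ Hb Hf Hg)].
  intros x. cbn. now destruct (b x).
Qed.

Lemma recb_negb b : recb O b -> recb O (fun x => negb (b x)).
Proof.
  intros Hb. eapply rec_ext; [|exact (rec_if b _ _ Hb (rec_const 0) (rec_const 1))].
  intros x. cbn. now destruct (b x).
Qed.

Lemma recb_andb b c : recb O b -> recb O c -> recb O (fun x => b x && c x).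
Proof. intros Hb Hc. exact (recb_if b c _ Hb Hc (recb_const false)). Qed.

Lemma recb_orb b c : recb O b -> recb O c -> recb O (fun x => b x || c x).
Proof. intros Hb Hc. exact (recb_if b _ c Hb (recb_const true) Hc). Qed.

Lemma recb_implb b c : recb O b -> recb O c -> recb O (fun x => implb (b x) (c x)).
Proof. intros Hb Hc. exact (recb_if b c _ Hb Hc (recb_const true)). Qed.

Lemma rec_pred f : rec O f -> rec O (fun x => pred (f x)).
Proof.
  intros Hf.
  apply rec_ext with (f := fun x => nat_rect (fun _ => nat) 0 ((fun _ m _ => m) x) (f x)).
  - intros x. now destruct (f x).
  - apply rec_rect; unfold rec3; auto using rec_const, rec_l, rec_r, rec_id.
Qed.

Lemma rec_sub f g : rec O f -> rec O g -> rec O (fun x => f x - g x).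
Proof.
  intros Hf Hg.
  apply rec_ext with (f := fun x => nat_rect (fun _ => nat) (f x) ((fun _ _ r => pred r) x) (g x)).
  - intros x. induction (g x) as [|n IH]; cbn; [lia|]. cbn in IH. rewrite IH. lia.
  - apply rec_rect; unfold rec3; auto using rec_const, rec_l, rec_r, rec_id, rec_pred.
Qed.

Lemma recb_leb f g : rec O f -> rec O g -> recb O (fun x => f x <=? g x).
Proof.
  intros Hf Hg.
  apply rec_ext with (f := fun x => 1 - (f x - g x)).
  - intros x. destruct (Nat.leb_spec (f x) (g x)); cbn [Nat.b2n]; lia.
  - auto using rec_sub, rec_const.
Qed.

Lemma recb_ltb f g : rec O f -> rec O g -> recb O (fun x => f x <? g x).
Proof. intros Hf Hg. apply (recb_leb (fun x => S (f x)) g); auto using rec_S. Qed.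

Lemma recb_eqb f g : rec O f -> rec O g -> recb O (fun x => f x =? g x).
Proof.
  intros Hf Hg. apply recb_ext with (b := fun x => (f x <=? g x) && (g x <=? f x)).
  - intros x. destruct (Nat.eqb_spec (f x) (g x)), (Nat.leb_spec (f x) (g x)),
      (Nat.leb_spec (g x) (f x)); cbn; lia.
  - auto using recb_andb, recb_leb.
Qed.

End Closure.

(** * Bounded quantifiers, counting and search *)

Fixpoint allb (n : nat) (P : nat -> bool) : bool :=
  match n with 0 => true | S m => P m && allb m P end.

Fixpoint bcount (n : nat) (P : nat -> bool) : nat :=
  match n with 0 => 0 | S m => if P m then S (bcount m P) else bcount m P end.

(* The least [i < n] with [P i], and [n] if there is none. *)
Fixpoint bmin (n : nat) (P : nat -> bool) : nat :=
  match n with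
  | 0 => 0
  | S m => if bmin m P <? m then bmin m P else if P m then m else S m
  end.

(* [S i] for the greatest [i < n] with [P i], and [0] if there is none. *)
Fixpoint btop (n : nat) (P : nat -> bool) : nat :=
  match n with 0 => 0 | S m => if P m then S m else btop m P end.

Lemma allb_spec n P : allb n P = true <-> forall i, i < n -> P i = true.
Proof.
  induction n as [|n IH]; cbn; [split; [lia | auto]|].
  rewrite andb_true_iff, IH. split.
  - intros [H1 H2] i Hi. destruct (Nat.eq_dec i n) as [->|]; auto. apply H2. lia.
  - intros H. split; auto.
Qed.

Lemma bmin_spec n P :
  bmin n P <= n /\ (bmin n P < n -> P (bmin n P) = true) /\
  forall i, i < bmin n P -> P i = false.
Proof.
  induction n as [|n (H1 & H2 & H3)]; cbn [bmin]; [repeat split; lia|].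
  destruct (Nat.ltb_spec (bmin n P) n).
  - repeat split; [lia | auto | auto].
  - assert (bmin n P = n) as E by lia. rewrite E in *.
    destruct (P n) eqn:F; repeat split; auto; try lia.
    intros i Hi. destruct (Nat.eq_dec i n) as [->|]; auto. apply H3. lia.
Qed.

Lemma btop_S n P l : btop n P = S l ->
  l < n /\ P l = true /\ forall i, l < i < n -> P i = false.
Proof.
  induction n as [|n IH]; cbn; [lia|]. destruct (P n) eqn:F.
  - intros [= <-]. repeat split; auto; lia.
  - intros H. destruct (IH H) as (H1 & H2 & H3). repeat split; auto.
    intros i Hi. destruct (Nat.eq_dec i n) as [->|]; auto. apply H3. lia.
Qed.

Lemma btop_0 n P : btop n P = 0 -> forall i, i < n -> P i = false.
Proof.
  induction n as [|n IH]; cbn; [lia|]. destruct (P n) eqn:F; [lia|].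
  intros H i Hi. destruct (Nat.eq_dec i n) as [->|]; auto. apply IH; auto; lia.
Qed.

Lemma bcount_le n P : bcount n P <= n.
Proof. induction n; cbn; [lia|]. destruct (P n); lia. Qed.

Lemma bcount_mono n P P' : (forall i, i < n -> P i = true -> P' i = true) ->
  bcount n P <= bcount n P'.
Proof.
  induction n as [|n IH]; cbn; intros H; [lia|].
  assert (bcount n P <= bcount n P') by (apply IH; auto).
  destruct (P n) eqn:F; [rewrite (H n); [lia|lia|auto]|]. destruct (P' n); lia.
Qed.

(** As [P'] extends [P], any difference would raise the count. This lets one number stand for the
    truth values of all atoms of a table. *)
Lemma bcount_eq n P P' : (forall i, i < n -> P i = true -> P' i = true) ->
  bcount n P = bcount n P' -> forall i, i < n -> P i = P' i.
Proof.
  induction n as [|n IH]; cbn; intros H E i Hi; [lia|].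
  assert (bcount n P <= bcount n P') by (apply bcount_mono; auto).
  assert (P n = P' n /\ bcount n P = bcount n P') as [F E'].
  { destruct (P n) eqn:F.
    - pose proof (H n (Nat.lt_succ_diag_r n) F) as F'. rewrite F' in E. split; [congruence | lia].
    - destruct (P' n); split; auto; lia. }
  destruct (Nat.eq_dec i n) as [->|]; auto. apply IH; auto. lia.
Qed.

(** * Automation of computability proofs *)

Ltac rechyp := match goal with H : ?P |- ?Q => constr_eq P Q; exact H end.

Ltac recknown := fail.

(** A function with parameters matches at several arities; [multimatch] backtracks to one whose
    computability is known. *)
Ltac recapp := multimatch goal with
  | |- rec _ (fun x => ?f (@?a x) (@?b x) (@?c x)) =>
      apply (rec3_app f a b c); [solve [first [rechyp | recknown]] | | | ]
  | |- rec _ (fun x => ?f (@?a x) (@?b x)) => apply (rec2_app f a b); [solve [first [rechyp | recknown]] | | ]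
  | |- rec _ (fun x => ?f (@?a x)) => apply (rec_comp f a); [solve [first [rechyp | recknown]] | ]
  | |- recb _ (fun x => ?f (@?a x) (@?b x) (@?c x)) =>
      apply (recb3_app f a b c); [solve [first [rechyp | recknown]] | | | ]
  | |- recb _ (fun x => ?f (@?a x) (@?b x)) => apply (recb2_app f a b); [solve [first [rechyp | recknown]] | | ]
  | |- recb _ (fun x => ?f (@?a x)) => apply (recb_comp f a); [solve [first [rechyp | recknown]] | ]
  end.

Ltac recbase :=
  cbv beta;
  lazymatch goal with
  | |- rec _ (fun _ => ?k) => exact (rec_const k)
  | |- recb _ (fun _ => ?k) => exact (recb_const k)
  | |- rec _ (fun x => x) => exact rec_id
  | |- rec _ unpair_l => exact (rec_l _ rec_id)
  | |- rec _ unpair_r => exact (rec_r _ rec_id)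
  | |- rec _ (fun x => S (@?f x)) => apply (rec_S f)
  | |- rec _ (fun x => pred (@?f x)) => apply (rec_pred f)
  | |- rec _ (fun x => unpair_l (@?f x)) => apply (rec_l f)
  | |- rec _ (fun x => unpair_r (@?f x)) => apply (rec_r f)
  | |- rec _ (fun x => Cantor.to_nat (@?f x, @?g x)) => apply (rec_pair f g)
  | |- rec _ (fun x => @?f x - @?g x) => apply (rec_sub f g)
  | |- rec ?O (fun x => Nat.b2n (@?b x)) => change (recb O b)
  | |- rec _ (fun x => if @?b x then @?f x else @?g x) => apply (rec_if b f g)
  | |- recb _ (fun x => if @?b x then @?f x else @?g x) => apply (recb_if b f g)
  | |- recb _ (fun x => negb (@?b x)) => apply (recb_negb b)
  | |- recb _ (fun x => @?b x && @?c x) => apply (recb_andb b c)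
  | |- recb _ (fun x => @?b x || @?c x) => apply (recb_orb b c)
  | |- recb _ (fun x => implb (@?b x) (@?c x)) => apply (recb_implb b c)
  | |- recb _ (fun x => @?f x =? @?g x) => apply (recb_eqb f g)
  | |- recb _ (fun x => @?f x <=? @?g x) => apply (recb_leb f g)
  | |- recb _ (fun x => @?f x <? @?g x) => apply (recb_ltb f g)
  | |- _ => recapp
  end.

Ltac recstep := recbase.

Ltac recauto := repeat (first [rechyp | recstep]).

Section Bounded.

Context {O : natset}.

Lemma recb_allb n P : rec O n -> recb2 O P -> recb O (fun x => allb (n x) (P x)).
Proof.
  intros Hn HP.
  apply rec_ext with (f := fun x => nat_rect (fun _ => nat) 1
    ((fun x m r => if P x m then r else 0) x) (n x)).
  - intros x. induction (n x) as [|m IH]; cbn in *; auto. rewrite IH. now destruct (P x m).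
  - apply rec_rect; unfold rec3; recauto.
Qed.

Lemma rec_bcount n P : rec O n -> recb2 O P -> rec O (fun x => bcount (n x) (P x)).
Proof.
  intros Hn HP.
  apply rec_ext with (f := fun x => nat_rect (fun _ => nat) 0
    ((fun x m r => if P x m then S r else r) x) (n x)).
  - intros x. induction (n x) as [|m IH]; cbn in *; auto. now rewrite IH.
  - apply rec_rect; unfold rec3; recauto.
Qed.

Lemma rec_bmin n P : rec O n -> recb2 O P -> rec O (fun x => bmin (n x) (P x)).
Proof.
  intros Hn HP.
  apply rec_ext with (f := fun x => nat_rect (fun _ => nat) 0
    ((fun x m r => if r <? m then r else if P x m then m else S m) x) (n x)).
  - intros x. induction (n x) as [|m IH]; cbn in *; auto. now rewrite IH.
  - apply rec_rect; unfold rec3; recauto.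
Qed.

Lemma rec_btop n P : rec O n -> recb2 O P -> rec O (fun x => btop (n x) (P x)).
Proof.
  intros Hn HP.
  apply rec_ext with (f := fun x => nat_rect (fun _ => nat) 0
    ((fun x m r => if P x m then S m else r) x) (n x)).
  - intros x. induction (n x) as [|m IH]; cbn in *; auto. now rewrite IH.
  - apply rec_rect; unfold rec3; recauto.
Qed.

End Bounded.

Ltac recstep ::=
  cbv beta;
  lazymatch goal with
  | |- rec2 _ _ => unfold rec2
  | |- recb2 _ _ => unfold recb2
  | |- rec3 _ _ => unfold rec3
  | |- recb3 _ _ => unfold recb3
  | |- recb _ (fun x => allb (@?n x) (@?P x)) => apply (recb_allb n P)
  | |- rec _ (fun x => bcount (@?n x) (@?P x)) => apply (rec_bcount n P)
  | |- rec _ (fun x => bmin (@?n x) (@?P x)) => apply (rec_bmin n P)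
  | |- rec _ (fun x => btop (@?n x) (@?P x)) => apply (rec_btop n P)
  | |- _ => recbase
  end.

Fixpoint tab (F : nat -> nat -> nat -> nat) (u n : nat) : nat :=
  match n with 0 => 0 | S m => ⟨F u m (tab F u m), tab F u m⟩ end.

(* Course-of-values recursion: [F u n T] may read the value at [i < n] as [look T n i]. *)
Definition cov (F : nat -> nat -> nat -> nat) (u n : nat) : nat := F u n (tab F u n).

(** [tab] puts the newest value outermost, so the value at [i] lies under [n - S i] others. *)
Definition look (T n i : nat) : nat :=
  unpair_l (nat_rect (fun _ => nat) T (fun _ => unpair_r) (n - S i)).

Lemma look_tab F u n i : i < n -> look (tab F u n) n i = cov F u i.
Proof.
  unfold look. intros H.
  assert (forall k, k <= n -> nat_rect (fun _ => nat) (tab F u n) (fun _ => unpair_r) k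
    = tab F u (n - k)) as E.
  { induction k as [|k IH]; intros Hk; cbn; [now rewrite Nat.sub_0_r|].
    rewrite IH by lia. replace (n - k) with (S (n - S k)) by lia. cbn. now unp. }
  rewrite E by lia. replace (n - (n - S i)) with (S i) by lia. cbn. now unp.
Qed.

Lemma rec_look O : rec3 O look.
Proof.
  unfold rec3, look. apply rec_l.
  apply (rec_rect (fun x => unpair_l x) (fun x => unpair_l (unpair_r x) - S (unpair_r (unpair_r x)))
    (fun _ _ r => unpair_r r)); unfold rec3; recauto.
Qed.

Lemma rec_cov O F : rec3 O F -> rec2 O (cov F).
Proof.
  intros HF.
  assert (rec2 O (tab F)) as HT.
  { apply rec_ext with (f := fun z => nat_rect (fun _ => nat) 0
      ((fun z m r => ⟨F (unpair_l z) m r, r⟩) z) (unpair_r z)).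
    - intros z. induction (unpair_r z) as [|m IH]; cbn in *; auto. now rewrite IH.
    - apply rec_rect; unfold rec3; recauto. }
  unfold rec2, cov. recauto.
Qed.

Ltac recknown ::=
  lazymatch goal with
  | |- rec3 _ look => apply rec_look
  end.

(** * Oracles, search and s-m-n *)

Definition chr (P : Prop) : bool := if excluded_middle_informative P then true else false.

Lemma chr_true P : chr P = true <-> P.
Proof. unfold chr. destruct (excluded_middle_informative P); split; auto; discriminate. Qed.

Lemma chr_false P : chr P = false <-> ~ P.
Proof. unfold chr. destruct (excluded_middle_informative P); split; tauto || discriminate. Qed.

Lemma phi_encode O c x y : phi O (encode c) x y <-> eval O c x y.
Proof.
  split; [|intros; now exists c].
  intros (d & E & H). now apply encode_inj in E as ->.
Qed.

Lemma computes_fun_rec O f : computes_fun O f -> rec O f.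
Proof.
  intros [e H]. destruct (H 0) as (c & Hc & _). exists c. intros x.
  apply phi_encode. rewrite Hc. apply H.
Qed.

Lemma recb_chr_iff B O : recb O (fun x => chr (B x)) <-> turing_le B O.
Proof.
  split.
  - intros [c H]. exists (encode c). intros n. rewrite !phi_encode. specialize (H n).
    unfold chr in H. now destruct (excluded_middle_informative (B n)).
  - intros [e H].
    (* An index need not code a program; convergence at 0 shows that [e] does. *)
    assert (exists c, encode c = e) as [c Hc].
    { destruct (H 0) as [H1 H0]. destruct (classic (B 0)) as [h|h];
        [destruct (H1 h) as (c & E & _) | destruct (H0 h) as (c & E & _)]; eauto. }
    subst e. exists c. intros n. destruct (H n) as [H1 H0]. rewrite !phi_encode in *.
    unfold chr. destruct (excluded_middle_informative (B n)); cbn; auto.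
Qed.

Fixpoint subst_oracle (d c : code) : code :=
  match c with
  | Oracle => d
  | Pair f g => Pair (subst_oracle d f) (subst_oracle d g)
  | Comp f g => Comp (subst_oracle d f) (subst_oracle d g)
  | Prec f g => Prec (subst_oracle d f) (subst_oracle d g)
  | Mu f => Mu (subst_oracle d f)
  | _ => c
  end.

(** Replacing the [Oracle] instruction by a program that decides [B] preserves every convergent
    computation. *)
Lemma rec_trans B O f : turing_le B O -> rec B f -> rec O f.
Proof.
  intros HB [c Hc]. apply recb_chr_iff in HB as [d Hd].
  exists (subst_oracle d c). intros x. generalize (Hc x). generalize (f x) as y. clear Hc.
  revert x. induction c as [| | | | |f' IHf g IHg|f' IHf g IHg|f' IHf g IHg|f' IHf];
    cbn [eval subst_oracle]; intros x y; auto.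
  - intros H. specialize (Hd x). unfold chr in Hd.
    destruct (excluded_middle_informative (B x)), H as [[? ->]|[? ->]]; tauto || exact Hd.
  - intros (u & v & H1 & H2 & ->). exists u, v. auto.
  - intros (z & H1 & H2). exists z. auto.
  - generalize (unpair_r x) as n. intros n. revert y.
    induction n as [|n IH]; cbn; intros y; auto. intros (r & H1 & H2). exists r. auto.
  - intros [H1 H2]. split; auto. intros z Hz. destruct (H2 z Hz) as [v Hv]. eauto.
Qed.

Lemma turing_le_empty O : turing_le empty O.
Proof. exists (encode Zero). intros n. rewrite !phi_encode. split; [intros [] | reflexivity]. Qed.

(** [Mu] looks for a zero and is therefore run on the negated test. The result is only claimed to
    come from some witness, which suffices later. *)
Lemma search_code O b v : recb O b -> rec O v ->
  exists c, forall x,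
    (forall r, eval O c x r -> exists y, b ⟨x, y⟩ = true /\ r = v ⟨x, y⟩) /\
    (forall y, b ⟨x, y⟩ = true -> exists r, eval O c x r).
Proof.
  intros Hb [cv Hv]. apply recb_negb in Hb as [cb Hb].
  exists (Comp cv (Pair (Pair Left Right) (Mu cb))). intros x.
  assert (eval O (Pair Left Right) x x) as Hid.
  { exists (unpair_l x), (unpair_r x). cbn. now rewrite pair_unpair. }
  split.
  - intros r (z & (u & y & Hu & [Hy _] & ->) & Hr).
    rewrite (eval_functional _ _ _ _ _ Hu Hid) in Hr. exists y.
    pose proof (eval_functional _ _ _ _ _ Hy (Hb _)) as E. split.
    + now destruct (b ⟨x, y⟩).
    + exact (eval_functional _ _ _ _ _ Hr (Hv _)).
  - intros y0 H0.
    assert (exists y, b ⟨x, y⟩ = true /\ forall z, z < y -> b ⟨x, z⟩ = false) as (y & Hy & Hm).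
    { clear Hb Hv. revert H0. induction y0 as [y0 IH] using lt_wf_ind. intros H0.
      destruct (classic (exists z, z < y0 /\ b ⟨x, z⟩ = true)) as [(z & Hz & E)|N]; eauto.
      exists y0. split; auto. intros z Hz. destruct (b ⟨x, z⟩) eqn:E; auto.
      destruct N. eauto. }
    exists (v ⟨x, y⟩), ⟨x, y⟩. split; auto. exists x, y. repeat split; auto.
    + specialize (Hb ⟨x, y⟩). now rewrite Hy in Hb.
    + intros z Hz. exists 0. specialize (Hb ⟨x, z⟩). now rewrite (Hm z Hz) in Hb.
Qed.

Fixpoint const_code (k : nat) : code :=
  match k with 0 => Zero | S m => Comp Succ (const_code m) end.

(** Arithmetic version of [encode (const_code k)], which makes [smn] visibly computable. *)
Definition const_index (k : nat) : nat :=
  nat_rect (fun _ => nat) (encode Zero) (fun _ r => ⟨6, ⟨encode Succ, r⟩⟩) k.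

Definition smn (p a : nat) : nat := ⟨6, ⟨p, ⟨5, ⟨const_index a, encode (Pair Left Right)⟩⟩⟩⟩.

Lemma encode_const_code k : encode (const_code k) = const_index k.
Proof. induction k as [|k IH]; cbn [const_code encode]; [reflexivity|]. now rewrite IH. Qed.

Lemma smn_code c a : smn (encode c) a = encode (Comp c (Pair (const_code a) (Pair Left Right))).
Proof. cbn [encode]. now rewrite encode_const_code. Qed.

Lemma phi_smn O c a x y : phi O (smn (encode c) a) x y <-> eval O c ⟨a, x⟩ y.
Proof.
  rewrite smn_code, phi_encode.
  assert (eval O (Pair (const_code a) (Pair Left Right)) x ⟨a, x⟩) as H.
  { exists a, x. repeat split.
    - induction a as [|a IH]; cbn; eauto.
    - exists (unpair_l x), (unpair_r x). cbn. now rewrite pair_unpair. }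
  split.
  - intros (z & Hz & Hy). now rewrite (eval_functional _ _ _ _ _ Hz H) in Hy.
  - intros Hy. now exists ⟨a, x⟩.
Qed.

Lemma rec_smn O : rec2 O smn.
Proof.
  unfold rec2, smn, const_index. recauto.
  apply (rec_rect (fun _ => encode Zero) (fun x => unpair_r x) (fun _ _ r => ⟨6, ⟨encode Succ, r⟩⟩));
    unfold rec3; recauto.
Qed.


(** * Deciding which numbers code programs *)

Definition is_code_step (_ e T : nat) : nat :=
  let t := unpair_l e in
  let a := unpair_r e in
  if t <? 5 then (if a =? 0 then 1 else 0)
  else if t <? 8 then
    (if (look T e (unpair_l a) =? 1) && (look T e (unpair_r a) =? 1) then 1 else 0)
  else if t =? 8 then look T e a
  else 0.

Definition is_code (e : nat) : bool := cov is_code_step 0 e =? 1.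

Lemma recb_is_code O : recb O is_code.
Proof.
  apply (recb_ext (fun e => is_code e)); auto.
  assert (rec2 O (cov is_code_step)) by (apply rec_cov; unfold is_code_step; cbv zeta; recauto).
  unfold is_code. recauto.
Qed.

Ltac recknown ::=
  lazymatch goal with
  | |- rec3 _ look => apply rec_look
  | |- rec2 _ smn => apply rec_smn
  | |- recb _ is_code => apply recb_is_code
  end.

(** Composite codes have a tag of at least 5, so their components are smaller and course-of-values
    recursion reaches them. *)
Lemma unpair_lt e : 1 <= unpair_l e -> unpair_r e < e.
Proof. intros H. pose proof (pair_ge (unpair_l e) (unpair_r e)). rewrite pair_unpair in *. lia. Qed.

Lemma unpair_l_le e : unpair_l e <= e.
Proof. pose proof (pair_ge (unpair_l e) (unpair_r e)). rewrite pair_unpair in *. lia. Qed.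

Lemma unpair_r_le e : unpair_r e <= e.
Proof. pose proof (pair_ge (unpair_l e) (unpair_r e)). rewrite pair_unpair in *. lia. Qed.

Lemma is_code_eq e : is_code e =
  let t := unpair_l e in let a := unpair_r e in
  if t <? 5 then a =? 0
  else if t <? 8 then is_code (unpair_l a) && is_code (unpair_r a)
  else (t =? 8) && is_code a.
Proof.
  unfold is_code. unfold cov at 1. unfold is_code_step at 1. cbv zeta.
  destruct (Nat.ltb_spec (unpair_l e) 5) as [H5|H5].
  - now destruct (unpair_r e =? 0).
  - pose proof (unpair_lt e ltac:(lia)).
    pose proof (unpair_l_le (unpair_r e)). pose proof (unpair_r_le (unpair_r e)).
    destruct (Nat.ltb_spec (unpair_l e) 8).
    + rewrite !look_tab by lia. now destruct (_ && _).
    + destruct (unpair_l e =? 8); auto. now rewrite look_tab.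
Qed.

Lemma is_code_spec e : is_code e = true <-> exists c, encode c = e.
Proof.
  split.
  - induction e as [e IH] using lt_wf_ind. rewrite is_code_eq. cbv zeta.
    intros H0. rewrite <- (pair_unpair e). revert H0. remember (unpair_l e) as t eqn:Et.
    destruct (Nat.ltb_spec t 5) as [H5|H5].
    + intros H. apply Nat.eqb_eq in H. rewrite H.
      destruct t as [|[|[|[|[|]]]]]; [now exists Zero | now exists Succ | now exists Left
        | now exists Right | now exists Oracle | lia].
    + pose proof (unpair_lt e ltac:(lia)).
      pose proof (unpair_l_le (unpair_r e)). pose proof (unpair_r_le (unpair_r e)).
      destruct (Nat.ltb_spec t 8).
      * rewrite andb_true_iff. intros [Ha Hb].
        apply IH in Ha as [c Hc]; [|lia]. apply IH in Hb as [d Hd]; [|lia].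
        rewrite <- (pair_unpair (unpair_r e)), <- Hc, <- Hd.
        assert (t = 5 \/ t = 6 \/ t = 7) as Et' by lia. clear Et.
        destruct Et' as [->|[->| ->]];
          [now exists (Pair c d) | now exists (Comp c d) | now exists (Prec c d)].
      * rewrite andb_true_iff, Nat.eqb_eq. intros [Et' Ha]. rewrite Et'.
        apply IH in Ha as [c Hc]; [|lia]. rewrite <- Hc. now exists (Mu c).
  - intros [c <-].
    induction c as [| | | | |f IHf g IHg|f IHf g IHg|f IHf g IHg|f IHf];
      rewrite is_code_eq; cbn [encode]; cbv zeta; unp; cbn; unp; rewrite ?IHf, ?IHg; reflexivity.
Qed.

(** * A universal machine *)

(** Machine states: evaluate [e] at [x], or return [v], with stack [K]. The filler 0 in [Rt] puts
    [v] and [K] where [Ev] has [x] and [K]. *)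
Definition Ev (e x K : nat) : nat := ⟨0, ⟨e, ⟨x, K⟩⟩⟩.
Definition Rt (v K : nat) : nat := ⟨1, ⟨0, ⟨v, K⟩⟩⟩.
(** The successor keeps 0 for the empty stack. Tags 0 and 1 await the components of a [Pair], 2 the
    inner value of a [Comp]; 3 is a [Prec] loop with counter and bound, 4 a [Mu] search. *)
Definition frame (t b K : nat) : nat := S ⟨⟨t, b⟩, K⟩.

Definition step_eval (qx s t a x K : nat) : nat :=
  if t =? 0 then Rt 0 K
  else if t =? 1 then Rt (S x) K
  else if t =? 2 then Rt (unpair_l x) K
  else if t =? 3 then Rt (unpair_r x) K
  else if t =? 4 then (if qx <? 2 then Rt qx K else s)
  else if t =? 5 then Ev (unpair_l a) x (frame 0 ⟨unpair_r a, x⟩ K)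
  else if t =? 6 then Ev (unpair_r a) x (frame 2 (unpair_l a) K)
  else if t =? 7 then
    Ev (unpair_l a) (unpair_l x) (frame 3 ⟨⟨unpair_r a, unpair_l x⟩, ⟨0, unpair_r x⟩⟩ K)
  else Ev a ⟨x, 0⟩ (frame 4 ⟨a, ⟨x, 0⟩⟩ K).

Definition step_return (t b v K : nat) : nat :=
  if t =? 0 then Ev (unpair_l b) (unpair_r b) (frame 1 v K)
  else if t =? 1 then Rt ⟨b, v⟩ K
  else if t =? 2 then Ev b v K
  else if t =? 3 then
    let ga := unpair_l b in
    let m := unpair_l (unpair_r b) in
    let n := unpair_r (unpair_r b) in
    if m =? n then Rt v K
    else Ev (unpair_l ga) ⟨unpair_r ga, ⟨m, v⟩⟩ (frame 3 ⟨ga, ⟨S m, n⟩⟩ K)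
  else
    let x := unpair_l (unpair_r b) in
    let i := unpair_r (unpair_r b) in
    if v =? 0 then Rt i K
    else Ev (unpair_l b) ⟨x, S i⟩ (frame 4 ⟨unpair_l b, ⟨x, S i⟩⟩ K).

(* One step of a stack machine evaluating codes.  The query answers [q x] are 0
   for no, 1 for yes, and anything else blocks the machine. *)
Definition step (q : nat -> nat) (s : nat) : nat :=
  let e := unpair_l (unpair_r s) in
  let x := unpair_l (unpair_r (unpair_r s)) in
  let K := unpair_r (unpair_r (unpair_r s)) in
  if unpair_l s =? 0 then step_eval (q x) s (unpair_l e) (unpair_r e) x K
  else if K =? 0 then s
  else step_return (unpair_l (unpair_l (pred K))) (unpair_r (unpair_l (pred K))) x
         (unpair_r (pred K)).

Definition steps (q : nat -> nat) (n s : nat) : nat :=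
  nat_rect (fun _ => nat) s (fun _ r => step q r) n.

(* The result of [n] steps: [S y] if the machine has halted with output [y], else [0]. *)
Definition run (q : nat -> nat) (e x n : nat) : nat :=
  let s := steps q n (Ev e x 0) in
  if is_code e && (unpair_l s =? 1) && (unpair_r (unpair_r (unpair_r s)) =? 0)
  then S (unpair_l (unpair_r (unpair_r s))) else 0.

Lemma rec_run O (q : nat -> nat -> nat) (t e x n : nat -> nat) : rec2 O q ->
  rec O t -> rec O e -> rec O x -> rec O n ->
  rec O (fun z => run (q (t z)) (e z) (x z) (n z)).
Proof.
  intros Hq Ht He Hx Hn.
  assert (rec O (fun z => steps (q (t z)) (n z) (Ev (e z) (x z) 0))) as Hs.
  { apply (rec_rect (fun z => Ev (e z) (x z) 0) n (fun z _ r => step (q (t z)) r));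
      unfold rec3, step, step_eval, step_return, Ev, Rt, frame; cbv zeta; recauto. }
  unfold run. cbv zeta. recauto.
Qed.

Lemma steps_add q m n s : steps q (m + n) s = steps q n (steps q m s).
Proof.
  rewrite Nat.add_comm. unfold steps. induction n as [|n IH]; cbn; congruence.
Qed.

Lemma steps_S q n s : steps q (S n) s = steps q n (step q s).
Proof. exact (steps_add q 1 n s). Qed.

Ltac stp := unfold step, step_eval, step_return, Ev, Rt, frame; cbn [encode]; cbv zeta; unp;
  cbn [pred Nat.eqb]; unp; cbn [pred Nat.eqb]; unp.

Lemma step_Zero q x K : step q (Ev (encode Zero) x K) = Rt 0 K.
Proof. now stp. Qed.

Lemma step_Succ q x K : step q (Ev (encode Succ) x K) = Rt (S x) K.
Proof. now stp. Qed.

Lemma step_Left q x K : step q (Ev (encode Left) x K) = Rt (unpair_l x) K.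
Proof. now stp. Qed.

Lemma step_Right q x K : step q (Ev (encode Right) x K) = Rt (unpair_r x) K.
Proof. now stp. Qed.

Lemma step_Oracle q x K : step q (Ev (encode Oracle) x K) =
  if q x <? 2 then Rt (q x) K else Ev (encode Oracle) x K.
Proof. now stp. Qed.

Lemma step_Pair q f g x K : step q (Ev (encode (Pair f g)) x K) =
  Ev (encode f) x (frame 0 ⟨encode g, x⟩ K).
Proof. now stp. Qed.

Lemma step_Comp q f g x K : step q (Ev (encode (Comp f g)) x K) =
  Ev (encode g) x (frame 2 (encode f) K).
Proof. now stp. Qed.

Lemma step_Prec q f g x K : step q (Ev (encode (Prec f g)) x K) =
  Ev (encode f) (unpair_l x) (frame 3 ⟨⟨encode g, unpair_l x⟩, ⟨0, unpair_r x⟩⟩ K).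
Proof. now stp. Qed.

Lemma step_Mu q f x K : step q (Ev (encode (Mu f)) x K) =
  Ev (encode f) ⟨x, 0⟩ (frame 4 ⟨encode f, ⟨x, 0⟩⟩ K).
Proof. now stp. Qed.

Lemma step_frame0 q v g x K : step q (Rt v (frame 0 ⟨g, x⟩ K)) = Ev g x (frame 1 v K).
Proof. now stp. Qed.

Lemma step_frame1 q v u K : step q (Rt v (frame 1 u K)) = Rt ⟨u, v⟩ K.
Proof. now stp. Qed.

Lemma step_frame2 q v f K : step q (Rt v (frame 2 f K)) = Ev f v K.
Proof. now stp. Qed.

Lemma step_frame3 q v g a m n K : step q (Rt v (frame 3 ⟨⟨g, a⟩, ⟨m, n⟩⟩ K)) =
  if m =? n then Rt v K else Ev g ⟨a, ⟨m, v⟩⟩ (frame 3 ⟨⟨g, a⟩, ⟨S m, n⟩⟩ K).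
Proof. now stp. Qed.

Lemma step_frame4 q v f x i K : step q (Rt v (frame 4 ⟨f, ⟨x, i⟩⟩ K)) =
  if v =? 0 then Rt i K else Ev f ⟨x, S i⟩ (frame 4 ⟨f, ⟨x, S i⟩⟩ K).
Proof. now stp. Qed.

Lemma step_halt q v : step q (Rt v 0) = Rt v 0.
Proof. now stp. Qed.

Lemma Rt_inj v w K K' : Rt v K = Rt w K' -> v = w /\ K = K'.
Proof.
  unfold Rt. intros H. apply pair_inj in H as [_ H]. apply pair_inj in H as [_ H].
  now apply pair_inj in H.
Qed.

Lemma Ev_Rt e x K v K' : Ev e x K <> Rt v K'.
Proof. unfold Ev, Rt. intros H. apply pair_inj in H as [H _]. discriminate. Qed.

Lemma steps_halt q n v : steps q n (Rt v 0) = Rt v 0.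
Proof. induction n as [|n IH]; auto. now rewrite steps_S, step_halt. Qed.

Definition agrees (O : natset) (N : nat) (q : nat -> nat) : Prop :=
  forall m, m < N -> (O m -> q m = 1) /\ (~ O m -> q m = 0).

(** Use and number of steps are chosen before the query function and the stack, so subcomputations
    can be run above any frame. *)
Definition ev_reach (O : natset) (e x y : nat) : Prop :=
  exists N n, forall q, agrees O N q -> forall K, steps q n (Ev e x K) = Rt y K.

Lemma agrees_le O M N q : M <= N -> agrees O N q -> agrees O M q.
Proof. intros H A m Hm. apply A. lia. Qed.

Lemma steps_complete O c x y : eval O c x y -> ev_reach O (encode c) x y.
Proof.
  revert x y. induction c as [| | | | |f IHf g IHg|f IHf g IHg|f IHf g IHg|f IHf]; intros x y.
  - intros ->. exists 0, 1. intros. now rewrite steps_S, step_Zero.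
  - intros ->. exists 0, 1. intros. now rewrite steps_S, step_Succ.
  - intros ->. exists 0, 1. intros. now rewrite steps_S, step_Left.
  - intros ->. exists 0, 1. intros. now rewrite steps_S, step_Right.
  - intros H. exists (S x), 1. intros q A K. rewrite steps_S, step_Oracle.
    destruct (A x) as [A1 A0]; [lia|].
    destruct H as [[H ->]|[H ->]]; [rewrite A1|rewrite A0]; auto.
  - intros (u & v & Hf & Hg & ->).
    destruct (IHf _ _ Hf) as (N & n & Hn), (IHg _ _ Hg) as (M & m & Hm).
    exists (max N M), (S (n + S (m + 1))). intros q A K.
    rewrite steps_S, step_Pair, steps_add, Hn by (eapply agrees_le; [|eauto]; lia).
    rewrite steps_S, step_frame0, steps_add, Hm by (eapply agrees_le; [|eauto]; lia).
    apply step_frame1.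
  - intros (z & Hg & Hf).
    destruct (IHf _ _ Hf) as (N & n & Hn), (IHg _ _ Hg) as (M & m & Hm).
    exists (max N M), (S (m + S n)). intros q A K.
    rewrite steps_S, step_Comp, steps_add, Hm by (eapply agrees_le; [|eauto]; lia).
    rewrite steps_S, step_frame2. apply Hn. eapply agrees_le; [|eauto]. lia.
  - cbn [eval]. generalize (eq_refl (unpair_r x)). generalize (unpair_r x) at 2 3 as n0.
    intros n0 E H.
    (* Loop invariant: after [n] rounds the value returns to a frame with counter [n], while the
       bound [n0] stays fixed. *)
    assert (forall n y, n <= n0 -> prec_graph (eval O f) (eval O g) (unpair_l x) n y ->
      exists N k, forall q, agrees O N q -> forall K, steps q k (Ev (encode (Prec f g)) x K)
        = Rt y (frame 3 ⟨⟨encode g, unpair_l x⟩, ⟨n, n0⟩⟩ K)) as L.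
    { clear y H. induction n as [|n IH]; cbn [prec_graph]; intros y Hle.
      - intros Hf. destruct (IHf _ _ Hf) as (N & k & Hk). exists N, (S k). intros q A K.
        rewrite steps_S, step_Prec, Hk, E by auto. reflexivity.
      - intros (r & H1 & H2). apply IH in H1 as (N & k & Hk); [|lia].
        destruct (IHg _ _ H2) as (M & m & Hm).
        exists (max N M), (k + S m). intros q A K.
        rewrite steps_add, Hk by (eapply agrees_le; [|eauto]; lia).
        rewrite steps_S, step_frame3. destruct (Nat.eqb_spec n n0); [lia|].
        apply Hm. eapply agrees_le; [|eauto]. lia. }
    apply L in H as (N & k & Hk); [|lia]. exists N, (k + 1). intros q A K.
    rewrite steps_add, Hk by auto. rewrite steps_S, step_frame3, Nat.eqb_refl. reflexivity.
  - intros [H0 H].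
    (* Every candidate up to [y] gets tested, because the earlier ones return successors. *)
    assert (forall i, i <= y -> exists N k, forall q, agrees O N q -> forall K,
      steps q k (Ev (encode (Mu f)) x K) = Ev (encode f) ⟨x, i⟩ (frame 4 ⟨encode f, ⟨x, i⟩⟩ K)) as L.
    { induction i as [|i IH]; intros Hi.
      - exists 0, 1. intros q A K. rewrite steps_S, step_Mu. reflexivity.
      - destruct IH as (N & k & Hk); [lia|]. destruct (H i) as [v Hv]; [lia|].
        destruct (IHf _ _ Hv) as (M & m & Hm).
        exists (max N M), (k + (m + 1)). intros q A K.
        rewrite steps_add, Hk by (eapply agrees_le; [|eauto]; lia).
        rewrite steps_add, Hm by (eapply agrees_le; [|eauto]; lia).
        rewrite steps_S, step_frame4. reflexivity. }
    destruct (L y) as (N & k & Hk); [lia|]. destruct (IHf _ _ H0) as (M & m & Hm).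
    exists (max N M), (k + (m + 1)). intros q A K.
    rewrite steps_add, Hk by (eapply agrees_le; [|eauto]; lia).
    rewrite steps_add, Hm by (eapply agrees_le; [|eauto]; lia).
    rewrite steps_S, step_frame4. reflexivity.
Qed.

(** Answers 0 and 1 are correct and others only block, so a run that halts must return to [K] with a
    correct value. The decrease [m < n] of the remaining steps drives the induction for [Mu]. *)
Lemma steps_sound O q c x n K z :
  (forall m, (q m = 1 -> O m) /\ (q m = 0 -> ~ O m)) ->
  steps q n (Ev (encode c) x K) = Rt z 0 ->
  exists y m, eval O c x y /\ m < n /\ steps q m (Rt y K) = Rt z 0.
Proof.
  intros A.
  assert (forall n e x K, steps q n (Ev e x K) = Rt z 0 ->
    exists m, n = S m /\ steps q m (step q (Ev e x K)) = Rt z 0) as Hpos.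
  { intros [|m] e' x' K' H; [now apply Ev_Rt in H|]. exists m. now rewrite <- steps_S. }
  assert (forall n v t b K, steps q n (Rt v (frame t b K)) = Rt z 0 ->
    exists m, n = S m /\ steps q m (step q (Rt v (frame t b K))) = Rt z 0) as Hpos'.
  { intros [|m] v' t' b' K' H; [now apply Rt_inj in H|]. exists m. now rewrite <- steps_S. }
  revert x n K. induction c as [| | | | |f IHf g IHg|f IHf g IHg|f IHf g IHg|f IHf]; intros x n K H.
  - apply Hpos in H as (m & -> & H). rewrite step_Zero in H. exists 0, m. repeat split; auto.
  - apply Hpos in H as (m & -> & H). rewrite step_Succ in H. exists (S x), m. repeat split; auto.
  - apply Hpos in H as (m & -> & H). rewrite step_Left in H. eexists _, m. repeat split; eauto.
  - apply Hpos in H as (m & -> & H). rewrite step_Right in H. eexists _, m. repeat split; eauto.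
  (* A blocked query repeats its state, so the induction is on the steps. *)
  - induction n as [|n IH]; [now apply Ev_Rt in H|].
    rewrite steps_S, step_Oracle in H. destruct (Nat.ltb_spec (q x) 2).
    + exists (q x), n. repeat split; auto. cbn. specialize (A x).
      destruct (q x) as [|[|]]; [right|left|lia]; tauto.
    + destruct (IH H) as (y & m & ? & ? & ?). exists y, m. auto.
  - apply Hpos in H as (m & -> & H). rewrite step_Pair in H.
    apply IHf in H as (u & m1 & Hu & L1 & H). apply Hpos' in H as (m2 & -> & H).
    rewrite step_frame0 in H.
    apply IHg in H as (v & m3 & Hv & L2 & H). apply Hpos' in H as (m4 & -> & H).
    rewrite step_frame1 in H. exists ⟨u, v⟩, m4. repeat split; auto; [|lia]. exists u, v. auto.
  - apply Hpos in H as (m & -> & H). rewrite step_Comp in H.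
    apply IHg in H as (u & m1 & Hu & L1 & H). apply Hpos' in H as (m2 & -> & H).
    rewrite step_frame2 in H.
    apply IHf in H as (v & m3 & Hv & L2 & H). exists v, m3. repeat split; auto; [|lia]. exists u; auto.
  - apply Hpos in H as (m & -> & H). rewrite step_Prec in H.
    apply IHf in H as (u & m1 & Hu & L1 & H).
    assert (forall d i u m1, unpair_r x = i + d ->
      prec_graph (eval O f) (eval O g) (unpair_l x) i u ->
      steps q m1 (Rt u (frame 3 ⟨⟨encode g, unpair_l x⟩, ⟨i, unpair_r x⟩⟩ K)) = Rt z 0 ->
      exists y m, eval O (Prec f g) x y /\ m < m1 /\ steps q m (Rt y K) = Rt z 0) as L.
    { clear u m1 Hu L1 H. induction d as [|d IH]; intros i u m1 E Hu H;
        apply Hpos' in H as (m2 & -> & H); rewrite step_frame3 in H.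
      - destruct (Nat.eqb_spec i (unpair_r x)) as [E'|]; [|lia]. exists u, m2.
        repeat split; auto. cbn. now rewrite <- E'.
      - destruct (Nat.eqb_spec i (unpair_r x)) as [E'|]; [lia|].
        apply IHg in H as (v & m3 & Hv & L2 & H).
        apply IH in H as (y & m4 & ? & ? & ?); [| lia | cbn; eauto].
        exists y, m4. repeat split; auto. lia. }
    destruct (L (unpair_r x) 0 u m1) as (y & m2 & ? & ? & ?); auto.
    exists y, m2. repeat split; auto. lia.
  - apply Hpos in H as (m & -> & H). rewrite step_Mu in H.
    assert (forall m i, (forall j, j < i -> exists v, eval O f ⟨x, j⟩ (S v)) ->
      steps q m (Ev (encode f) ⟨x, i⟩ (frame 4 ⟨encode f, ⟨x, i⟩⟩ K)) = Rt z 0 ->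
      exists y m', eval O (Mu f) x y /\ m' < m /\ steps q m' (Rt y K) = Rt z 0) as L.
    { clear m H. induction m as [m IH] using lt_wf_ind. intros i Hi H.
      apply IHf in H as (v & m1 & Hv & L1 & H). apply Hpos' in H as (m2 & -> & H).
      rewrite step_frame4 in H. destruct v as [|v]; cbn [Nat.eqb] in H.
      - exists i, m2. repeat split; auto. lia.
      - apply IH in H as (y & m3 & ? & ? & ?); [|lia|].
        + exists y, m3. split; [assumption|split; [lia|assumption]].
        + intros j Hj. destruct (Nat.eq_dec j i) as [->|]; [eauto|]. apply Hi. lia. }
    destruct (L m 0) as (y & m2 & ? & ? & ?); auto; [intros; lia|].
    exists y, m2. split; [assumption|split; [lia|assumption]].
Qed.

Lemma run_iff q e x n y :
  run q e x n = S y <-> is_code e = true /\ steps q n (Ev e x 0) = Rt y 0.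
Proof.
  unfold run. cbv zeta. set (s := steps q n (Ev e x 0)). split.
  - destruct (is_code e); cbn [andb]; [|discriminate].
    destruct (Nat.eqb_spec (unpair_l s) 1) as [E1|]; cbn [andb]; [|discriminate].
    destruct (Nat.eqb_spec (unpair_r (unpair_r (unpair_r s))) 0) as [E2|]; [|discriminate].
    intros [= <-]. split; auto.
    (* [run] tests the tag and the stack but not the filler of [Rt]; this invariant of reachable
       states supplies it. *)
    assert (forall n s, unpair_l s = 0 \/ (exists v K, s = Rt v K) ->
      unpair_l (steps q n s) = 0 \/ (exists v K, steps q n s = Rt v K)) as I.
    { clear. induction n as [|n IH]; intros s Hs; auto. rewrite steps_S. apply IH.
      unfold step, step_eval, step_return. cbv zeta.
      repeat match goal with |- context [if ?b then _ else _] => destruct b end;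
        auto; unfold Ev; unp; eauto. }
    destruct (I n (Ev e x 0)) as [E|(v & K & E)].
    + left. unfold Ev. now unp.
    + fold s in E. lia.
    + fold s in E. rewrite E in *. unfold Rt in *. unp in *. now subst.
  - intros [-> ->]. unfold Rt. now unp.
Qed.

Lemma run_complete O e x y : phi O e x y ->
  exists N, forall q n, agrees O N q -> N <= n -> run q e x n = S y.
Proof.
  intros (c & <- & H). apply steps_complete in H as (N & k & Hk).
  exists (max N k). intros q n A Hn. apply run_iff. split; [apply is_code_spec; eauto|].
  replace n with (k + (n - k)) by lia. rewrite steps_add, Hk, steps_halt; auto.
  eapply agrees_le; [|eauto]. lia.
Qed.

Lemma run_sound O q e x n y :
  (forall m, (q m = 1 -> O m) /\ (q m = 0 -> ~ O m)) -> run q e x n = S y -> phi O e x y.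
Proof.
  intros A H. apply run_iff in H as [Hc H]. apply is_code_spec in Hc as [c <-].
  apply (steps_sound O) in H as (v & m & Hv & _ & H); auto.
  rewrite steps_halt in H. apply Rt_inj in H as [-> _]. now apply phi_encode.
Qed.

Lemma run_mono q q' e x n n' y : (forall m, q m < 2 -> q' m = q m) -> n <= n' ->
  run q e x n = S y -> run q' e x n' = S y.
Proof.
  intros A L. rewrite !run_iff. intros [Hc H]. split; auto.
  assert (forall n s, steps q n s = Rt y 0 -> steps q' n s = Rt y 0) as I.
  { clear - A. induction n as [|n IH]; intros s; auto. rewrite !steps_S. intros H.
    (* Where the two steps differ, [q] is blocked at [s]. A blocked state never changes, so [s] is
       already the halted state. *)
    assert (step q' s = step q s \/ step q s = s) as [E|E].
    - unfold step, step_eval. cbv zeta.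
      set (x := unpair_l (unpair_r (unpair_r s))).
      destruct (Nat.ltb_spec (q x) 2) as [h|h].
      + rewrite (A x h). destruct (Nat.ltb_spec (q x) 2); [auto|lia].
      + repeat match goal with |- context [if ?b then _ else _] =>
          lazymatch b with context [q'] => fail | context [unpair_l] => destruct b | _ => fail end end; auto.
    - rewrite E. auto.
    - rewrite E in H.
      assert (s = Rt y 0) as ->; [|rewrite step_halt; apply steps_halt].
      rewrite <- H. clear - E. induction n as [|n IH]; auto. now rewrite steps_S, E. }
  apply I in H. replace n' with (n + (n' - n)) by lia. now rewrite steps_add, H, steps_halt.
Qed.

(** * Truth tables and true stages *)

Definition bform_step (U : nat -> nat -> bool) (t m T : nat) : nat :=
  let a := unpair_r m in
  if unpair_l m =? 0 then Nat.b2n (U t a)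
  else if unpair_l m =? 1 then (if look T m a =? 1 then 0 else 1)
  else if unpair_l m =? 2 then
    Nat.b2n ((look T m (unpair_l a) =? 1) && (look T m (unpair_r a) =? 1))
  else Nat.b2n ((look T m (unpair_l a) =? 1) || (look T m (unpair_r a) =? 1)).

Definition eval_bform (U : nat -> nat -> bool) (t m : nat) : bool :=
  cov (bform_step U) t m =? 1.

Lemma recb_eval_bform O U : recb2 O U -> recb2 O (eval_bform U).
Proof.
  intros HU.
  assert (rec2 O (cov (bform_step U))).
    { apply rec_cov; unfold rec3, bform_step; cbv zeta. recauto. }
  unfold recb2, eval_bform. recauto.
Qed.

Lemma eval_bform_spec U t p :
  eval_bform U t (encode_bform p) = true <-> sat (fun k => U t k = true) p.
Proof.
  unfold eval_bform.
  induction p as [k|p IH|p IHp q IHq|p IHp q IHq]; cbn [sat encode_bform];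
    unfold cov, bform_step; cbv zeta; unp; cbn [Nat.eqb].
  - now destruct (U t k).
  - pose proof (pair_ge 1 (encode_bform p)).
    rewrite look_tab, <- IH by lia. now destruct (cov _ _ _ =? 1).
  - pose proof (pair_ge 2 ⟨encode_bform p, encode_bform q⟩).
    pose proof (pair_ge (encode_bform p) (encode_bform q)).
    rewrite !look_tab, <- IHp, <- IHq by lia.
    destruct (cov _ _ _ =? 1), (cov _ _ _ =? 1); cbn; intuition congruence.
  - pose proof (pair_ge 3 ⟨encode_bform p, encode_bform q⟩).
    pose proof (pair_ge (encode_bform p) (encode_bform q)).
    rewrite !look_tab, <- IHp, <- IHq by lia.
    destruct (cov _ _ _ =? 1), (cov _ _ _ =? 1); cbn; intuition congruence.
Qed.

(** Pairing dominates its arguments, so each atom is at most the code of its table. The code thus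
    bounds the atoms in advance. *)
Lemma sat_ext P Q p : (forall k, k <= encode_bform p -> (P k <-> Q k)) -> sat P p <-> sat Q p.
Proof.
  induction p as [k|p IH|p IHp q IHq|p IHp q IHq]; cbn [sat encode_bform]; intros H.
  - apply H. pose proof (pair_ge 0 k). lia.
  - pose proof (pair_ge 1 (encode_bform p)). rewrite IH; [tauto|]. intros; apply H; lia.
  - pose proof (pair_ge 2 ⟨encode_bform p, encode_bform q⟩).
    pose proof (pair_ge (encode_bform p) (encode_bform q)).
    rewrite IHp, IHq; [tauto| |]; intros; apply H; lia.
  - pose proof (pair_ge 3 ⟨encode_bform p, encode_bform q⟩).
    pose proof (pair_ge (encode_bform p) (encode_bform q)).
    rewrite IHp, IHq; [tauto| |]; intros; apply H; lia.
Qed.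

Lemma btop_ext n P Q : (forall i, i < n -> P i = Q i) -> btop n P = btop n Q.
Proof. induction n as [|n IH]; cbn; intros H; auto. rewrite H, IH; auto. Qed.

Lemma eventually_forall_lt (P : nat -> nat -> Prop) n :
  (forall i, i < n -> exists N, forall t, N <= t -> P i t) ->
  exists N, forall i t, i < n -> N <= t -> P i t.
Proof.
  induction n as [|n IH]; intros H; [exists 0; intros; lia|].
  destruct IH as [N HN]; [auto|]. destruct (H n) as [M HM]; [lia|].
  exists (max N M). intros i t Hi Ht. destruct (Nat.eq_dec i n) as [->|]; [apply HM | apply HN]; lia.
Qed.

Lemma ex_least (P : nat -> Prop) : (exists n, P n) -> exists n, P n /\ forall m, m < n -> ~ P m.
Proof.
  intros [n Hn]. revert Hn. induction n as [n IH] using lt_wf_ind. intros Hn.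
  destruct (classic (exists m, m < n /\ P m)) as [(m & L & Hm)|N]; eauto.
  exists n. split; auto. intros m L Hm. apply N. eauto.
Qed.

(* [At t] is the finite part of a c.e. set [A] enumerated by stage [t]; [tlen t] is the
   least number newly enumerated at [t], so that at infinitely many stages, the true
   ones, [At t] is correct below [tlen t]. *)
Definition tlen (At : nat -> nat -> bool) (t : nat) : nat :=
  bmin t (fun m => At t m && negb (At (pred t) m)).

(** When it holds with [l <= t], computations seen at [l] with queries below [tlen At l] still stand
    at [t]. *)
Definition valid (At : nat -> nat -> bool) (l t : nat) : bool :=
  allb (tlen At l) (fun m => implb (At t m) (At l m)).

Definition true_stage (A : natset) (At : nat -> nat -> bool) (t : nat) : Prop :=
  forall m, m < tlen At t -> A m -> At t m = true.

Lemma rec_tlen O At : recb2 O At -> rec O (tlen At).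
Proof. intros H. apply (rec_ext (fun x => tlen At x)); auto. unfold tlen. recauto. Qed.

Lemma recb_valid O At : recb2 O At -> recb2 O (valid At).
Proof. intros H. pose proof (rec_tlen _ _ H). unfold recb2, valid. recauto. Qed.

Section TrueStages.

Context {A : natset} {At : nat -> nat -> bool}.
Hypothesis At_mono : forall m t t', t <= t' -> At t m = true -> At t' m = true.
Hypothesis At_lim : forall m, A m <-> exists t, At t m = true.

Lemma valid_spec l t :
  valid At l t = true <-> forall m, m < tlen At l -> At t m = true -> At l m = true.
Proof.
  unfold valid. rewrite allb_spec. split; intros H m Hm; specialize (H m Hm);
    destruct (At t m), (At l m); auto.
Qed.

Lemma tlen_le t : tlen At t <= t.
Proof. apply bmin_spec. Qed.

Lemma tlen_new t m : m < t -> At t m = true -> At (pred t) m = false -> tlen At t <= m.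
Proof.
  intros L H1 H2. destruct (Nat.le_gt_cases (tlen At t) m) as [|h]; auto. exfalso.
  destruct (bmin_spec t (fun m => At t m && negb (At (pred t) m))) as (_ & _ & H).
  specialize (H m h). cbn in H. now rewrite H1, H2 in H.
Qed.

(** Otherwise the number [tlen At t], new at [t] and below [tlen At l], would refute the validity of
    [l]. *)
Lemma tlen_valid l t : l <= t -> valid At l t = true -> tlen At l <= tlen At t.
Proof.
  intros L V. rewrite valid_spec in V.
  destruct (Nat.le_gt_cases (tlen At l) (tlen At t)) as [|h]; auto. exfalso.
  pose proof (tlen_le l).
  destruct (bmin_spec t (fun m => At t m && negb (At (pred t) m))) as (_ & H1 & _).
  fold (tlen At t) in H1. specialize (H1 ltac:(lia)). apply andb_true_iff in H1 as [H1 H2].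
  apply V in H1; auto. apply negb_true_iff in H2.
  rewrite (At_mono _ l) in H2; [discriminate| |auto].
  destruct (Nat.eq_dec l t) as [->|]; [|lia]. lia.
Qed.

Lemma valid_weaken l l' t : l' <= t -> valid At l t = true -> valid At l l' = true.
Proof. rewrite !valid_spec. intros L V m Hm H. apply V; auto. now apply At_mono with l'. Qed.

Lemma true_stage_valid l t : true_stage A At l -> valid At l t = true.
Proof. rewrite valid_spec. intros T m Hm H. apply T; auto. apply At_lim. eauto. Qed.

(** By [tlen_valid], [At t] is correct below [tlen At l], and validity carries this back to [l]. So
    a push valid at a later true stage is valid forever. *)
Lemma valid_true_stage l t : l <= t -> true_stage A At t -> valid At l t = true -> true_stage A At l.
Proof.
  intros L T V m Hm H. pose proof (tlen_valid _ _ L V).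
  rewrite valid_spec in V. apply V; auto. apply T; auto. lia.
Qed.

Lemma not_true_stage_invalid l : ~ true_stage A At l ->
  exists N, forall t, N <= t -> valid At l t = false.
Proof.
  intros NT. apply not_all_ex_not in NT as [m Hm].
  apply imply_to_and in Hm as [Hm H]. apply imply_to_and in H as [HA HN].
  apply At_lim in HA as [N HAt]. exists N. intros t Ht.
  destruct (valid At l t) eqn:V; auto. destruct HN. rewrite valid_spec in V. apply V; auto.
  now apply At_mono with N.
Qed.

(** Take a stage from [N] on with [tlen] minimal. A number of [A] missing from it below [tlen] would
    enter later and produce a smaller [tlen]. *)
Lemma ex_true_stage N : exists t, N <= t /\ true_stage A At t.
Proof.
  destruct (ex_least (fun x => exists t, N <= t /\ tlen At t = x)) as (x & (t & Ht & Hx) & Hmin).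
  { exists (tlen At N). eauto. }
  exists t. split; auto. intros m Hm HA. destruct (At t m) eqn:E; auto. exfalso.
  apply At_lim in HA.
  destruct (ex_least _ HA) as (t' & Ht' & Hl).
  assert (t < t') as L.
  { destruct (Nat.le_gt_cases t' t) as [h|]; auto. now rewrite (At_mono m t' t h Ht') in E. }
  apply (Hmin (tlen At t')); [|exists t'; split; auto; lia].
  pose proof (tlen_le t).
  enough (tlen At t' <= m) by lia. apply tlen_new; auto; [lia|].
  destruct (At (pred t') m) eqn:F; auto. destruct (Hl (pred t')); auto. lia.
Qed.

Lemma At_settles m : exists N, forall t, N <= t -> (At t m = true <-> A m).
Proof.
  destruct (classic (A m)) as [h|h].
  - apply At_lim in h as [N HN]. exists N. intros t Ht. split.
    + intros; apply At_lim; eauto.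
    + intros _. now apply At_mono with N.
  - exists 0. intros t _. split; [|tauto]. intros; apply At_lim; eauto.
Qed.

Lemma tlen_lim N : exists M, forall t, M <= t -> N <= tlen At t.
Proof.
  destruct (eventually_forall_lt (fun m t => At t m = true <-> A m) N) as [M HM].
  { intros m _. apply At_settles. }
  (* The successor makes [pred t] lie beyond [M] as well. *)
  exists (S (max M N)). intros t Ht.
  destruct (Nat.le_gt_cases N (tlen At t)) as [|h]; auto. exfalso.
  destruct (bmin_spec t (fun m => At t m && negb (At (pred t) m))) as (_ & H1 & _).
  fold (tlen At t) in H1. specialize (H1 ltac:(lia)). apply andb_true_iff in H1 as [H1 H2].
  apply negb_true_iff in H2. apply (HM _ t) in H1; [|lia|lia].
  apply (HM _ (pred t)) in H1; [congruence|lia|lia].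
Qed.

End TrueStages.

(** * The construction *)

Section Construction.

Variables (At U : nat -> nat -> bool) (G : nat -> nat -> nat) (tb : nat -> nat) (q : nat).

(** In use, [u] is [⟨p, n⟩] with [p] a program that knows its own index and [n] the number whose
    halting is decided; [tb] gives the tables of superhighness and [q] asks whether growth stages
    are finitely many. *)
Definition table (u : nat) : nat := tb (smn q u).

Definition guess (u t : nat) : bool := eval_bform U t (table u).

(** The reserved points, indices of diagonalizing programs. Tag 0 separates them from the growth
    searches, which carry tag 1. *)
Definition pos (u j : nat) : nat := smn (unpair_l u) ⟨0, ⟨unpair_r u, j⟩⟩.

(** There is one point for every value of [label], which is at most [S (table u)]. *)
Definition same (u t l : nat) : bool :=
  allb (S (S (table u))) (fun j => G t (pos u j) =? G l (pos u j)).

(** Counts far enough to cover all atoms of the table. It does not decrease along valid stages and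
    selects the point reserved for a push. *)
Definition label (u t : nat) : nat := bcount (S (table u)) (U t).

(* [l] is [0] if no earlier push is valid, else the successor of the last valid one. *)
Definition push_rule (u t l : nat) : bool :=
  if l =? 0 then guess u t
  else if guess u (pred l) then negb (guess u t) && negb (same u t (pred l))
  else guess u t.

Definition push_step (u t T : nat) : nat :=
  Nat.b2n (push_rule u t (btop t (fun i => (look T t i =? 1) && valid At i t))).

Definition push (u t : nat) : bool := cov push_step u t =? 1.

Definition top (u t : nat) : nat := btop t (fun i => push u i && valid At i t).

(** The last valid push is of the first kind and outdated, but the guess still answers finitely
    many. If this happens infinitely often, that answer is refuted. *)
Definition growth (u t : nat) : bool :=
  (0 <? top u t) && guess u (pred (top u t)) && guess u t && negb (same u t (pred (top u t))).

Lemma push_eq u t : push u t = push_rule u t (top u t).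
Proof.
  unfold push at 1. unfold cov, push_step.
  rewrite (btop_ext _ _ (fun i => push u i && valid At i t)); fold (top u t).
  - now destruct (push_rule u t (top u t)).
  - intros i Hi. now rewrite look_tab.
Qed.

Section Computability.

Context {O : natset}.
Hypotheses (HAt : recb2 O At) (HU : recb2 O U) (HG : rec2 O G) (Htb : rec O tb).

Lemma rec_table : rec O table.
Proof. apply (rec_ext (fun u => table u)); auto. unfold table. recauto. Qed.

Lemma rec_pos : rec2 O pos.
Proof. unfold pos. recauto. Qed.

Lemma recb_guess : recb2 O guess.
Proof. pose proof rec_table. pose proof (recb_eval_bform _ _ HU). unfold guess. recauto. Qed.

Lemma recb_same : recb3 O same.
Proof. pose proof rec_table. pose proof rec_pos. unfold same. recauto. Qed.

Lemma rec_label : rec2 O label.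
Proof. pose proof rec_table. unfold label. recauto. Qed.

Lemma recb_push : recb2 O push.
Proof.
  pose proof recb_guess. pose proof recb_same. pose proof (recb_valid _ _ HAt).
  assert (rec2 O (cov push_step)).
  { apply rec_cov. unfold push_step, push_rule. recauto. }
  unfold push. recauto.
Qed.

Lemma recb_growth : recb2 O growth.
Proof.
  pose proof recb_guess. pose proof recb_same. pose proof recb_push.
  pose proof (recb_valid _ _ HAt).
  assert (rec2 O top) by (unfold top; recauto).
  unfold growth. recauto.
Qed.

End Computability.

Lemma label_bound u t : label u t < S (S (table u)).
Proof. unfold label. pose proof (bcount_le (S (table u)) (U t)). lia. Qed.

(** * Verification of the construction for a fixed [u] *)

Section Verification.

Context {u : nat} {b : bform}.
Hypothesis At_mono : forall m t t', t <= t' -> At t m = true -> At t' m = true.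
Hypothesis U_mono : forall l t k, l <= t -> valid At l t = true -> U l k = true -> U t k = true.
Hypothesis table_eq : table u = encode_bform b.

(** By [U_mono] and [bcount_eq], equal labels mean the same atoms, and the guess reads nothing
    else. *)
Lemma guess_eq t t' : label u t = label u t' ->
  t <= t' -> valid At t t' = true -> guess u t = guess u t'.
Proof.
  intros E L V. unfold label in E.
  assert (forall i, i < S (table u) -> U t i = U t' i) as H.
  { apply bcount_eq; auto. intros i _. now apply U_mono. }
  unfold guess. rewrite table_eq. apply eq_true_iff_eq. rewrite !eval_bform_spec.
  apply sat_ext. intros k Hk. rewrite H; [tauto|]. rewrite table_eq. lia.
Qed.

Lemma label_mono l t : l <= t -> valid At l t = true -> label u l <= label u t.
Proof. intros L V. apply bcount_mono. intros i _. now apply U_mono. Qed.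

Lemma top_S t l : top u t = S l -> l < t /\ push u l = true /\ valid At l t = true /\
  forall i, l < i < t -> push u i = true -> valid At i t = false.
Proof.
  intros H. apply btop_S in H as (H1 & H2 & H3). apply andb_true_iff in H2 as [H2 H4].
  repeat split; auto. intros i Hi P. specialize (H3 i Hi). cbn in H3. now rewrite P in H3.
Qed.

Lemma top_ge t l : l < t -> push u l = true -> valid At l t = true ->
  exists l', top u t = S l' /\ l <= l'.
Proof.
  intros L P V. destruct (top u t) as [|l'] eqn:E.
  - pose proof (btop_0 _ _ E l L) as H. cbn in H. now rewrite P, V in H.
  - exists l'. split; auto. apply top_S in E as (H1 & H2 & H3 & H4).
    destruct (Nat.le_gt_cases l l') as [|h]; auto. rewrite (H4 l) in V; [discriminate|lia|auto].
Qed.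

(* A push flips the guess, hence needs a new atom in the approximation of the jump. *)
Lemma label_lt l t : l < t -> push u l = true -> push u t = true -> valid At l t = true ->
  label u l < label u t.
Proof.
  intros L Pl Pt V. destruct (top_ge t l L Pl V) as (l' & E & L').
  destruct (top_S _ _ E) as (H1 & H2 & H3 & _).
  assert (label u l <= label u l').
  { apply label_mono; auto. now apply valid_weaken with t; [|lia|]. }
  assert (label u l' <= label u t) by (apply label_mono; [lia | auto]).
  enough (label u l' <> label u t) by lia. intros F.
  apply guess_eq in F; [|lia|auto]. rewrite push_eq, E in Pt. unfold push_rule in Pt.
  cbn [pred Nat.eqb] in Pt. rewrite F in Pt. now destruct (guess u t).
Qed.

(** The earlier push is still valid at the later one, so [label_lt] separates them. A point
    therefore serves only one push at a time. *)
Lemma label_inj l l' t : l < t -> l' < t -> push u l = true -> push u l' = true ->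
  valid At l t = true -> valid At l' t = true -> label u l = label u l' -> l = l'.
Proof.
  intros L L' P P' V V' E. destruct (Nat.lt_trichotomy l l') as [h|[h|h]]; auto.
  - pose proof (label_lt l l' h P P' (valid_weaken At_mono l l' t ltac:(lia) V)). lia.
  - pose proof (label_lt l' l h P' P (valid_weaken At_mono l' l t ltac:(lia) V')). lia.
Qed.

Context {A : natset} {g : nat -> nat}.
Hypothesis At_lim : forall m, A m <-> exists t, At t m = true.
Hypothesis U_sound : forall t k, true_stage A At t -> U t k = true -> jump A k.
Hypothesis U_lim : forall k, jump A k ->
  exists N, forall t, N <= t -> true_stage A At t -> U t k = true.
Hypothesis G_lim : forall v, exists N, forall t, N <= t -> G t v = g v.
Hypothesis table_correct : sat (jump A) b <-> exists x, forall t, x <= t -> growth u t = false.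

(** Only finitely many atoms matter, and at true stages [U] is right about each of them from some
    stage on. *)
Lemma guess_settles : exists N, forall t, N <= t -> true_stage A At t ->
  (guess u t = true <-> exists x, forall t, x <= t -> growth u t = false).
Proof.
  destruct (eventually_forall_lt (fun k t => true_stage A At t -> (U t k = true <-> jump A k))
    (S (table u))) as [N HN].
  { intros k _. destruct (classic (jump A k)) as [h|h].
    - destruct (U_lim k h) as [N HN]. exists N. intros t Ht T. split; auto.
    - exists 0. intros t _ T. split; [now apply U_sound | tauto]. }
  exists N. intros t Ht T. rewrite <- table_correct. unfold guess.
  rewrite table_eq, eval_bform_spec. apply sat_ext. intros k Hk. apply HN; auto.
  rewrite table_eq. lia.
Qed.

Definition settled (t : nat) : Prop :=
  forall j, j < S (S (table u)) -> G t (pos u j) = g (pos u j).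

Lemma ex_settled : exists N, forall t, N <= t -> settled t.
Proof.
  destruct (eventually_forall_lt (fun j t => G t (pos u j) = g (pos u j)) (S (S (table u))))
    as [N HN]; [auto|]. exists N. intros t Ht j Hj. auto.
Qed.

Lemma same_settled t l : settled t -> (same u t l = true <-> settled l).
Proof.
  intros H. unfold same. rewrite allb_spec.
  split; intros K j Hj; specialize (H j Hj); specialize (K j Hj).
  - apply Nat.eqb_eq in K. congruence.
  - apply Nat.eqb_eq. congruence.
Qed.

Definition permanent (l : nat) : Prop := push u l = true /\ true_stage A At l.

(* [m] is [0] if no stage is permanent, else the successor of the last permanent one. *)
Lemma ex_last_permanent : exists m,
  (forall l, permanent l -> l < m) /\ (m = 0 \/ permanent (pred m)).
Proof.
  (* Labels strictly increase along permanent stages and never exceed [S (table u)]; [d] bounds the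
     room left. *)
  assert (forall d l, permanent l -> S (table u) - label u l < d ->
    exists m, (forall l, permanent l -> l < m) /\ (m = 0 \/ permanent (pred m))) as L.
  { induction d as [|d IH]; intros l P Hd; [lia|].
    destruct (classic (exists l', l < l' /\ permanent l')) as [(l' & Ll & P')|N].
    - apply (IH l' P').
      pose proof (label_lt l l' Ll (proj1 P) (proj1 P') (true_stage_valid At_lim l l' (proj2 P))).
      pose proof (label_bound u l). pose proof (label_bound u l'). lia.
    - exists (S l). split; [|now right]. intros l' P'.
      destruct (Nat.le_gt_cases l' l); [lia|]. destruct N. eauto. }
  destruct (classic (exists l, permanent l)) as [[l P]|N].
  - eapply L; eauto.
  - exists 0. split; [|now left]. intros l P. destruct N. eauto.
Qed.

(** At a true stage the earlier pushes that are valid are exactly the permanent ones. *)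
Lemma top_true_stage m t :
  (forall l, permanent l -> l < m) -> (m = 0 \/ permanent (pred m)) ->
  m <= t -> true_stage A At t -> top u t = m.
Proof.
  intros Hm Pm L T.
  assert (forall l, top u t = S l -> l < m) as H.
  { intros l E. apply top_S in E as (H1 & H2 & H3 & _). apply Hm. split; auto.
    apply (valid_true_stage At_mono) with t; auto. lia. }
  destruct m as [|l].
  - destruct (top u t) as [|l]; auto. specialize (H l eq_refl). lia.
  - destruct Pm as [|[P1 P2]]; [discriminate|]. cbn [pred] in *.
    destruct (top_ge t l) as (l' & E & Hl); auto; [now apply (true_stage_valid At_lim)|].
    specialize (H l' E). rewrite E. f_equal. lia.
Qed.

(** At late true stages the last permanent push is on top, nothing is pushed and the guess is right.
    Every alternative to the claim makes that guess contradict the actual growth. *)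
Lemma ex_settled_permanent : exists l, permanent l /\ guess u l = true /\ settled l.
Proof.
  destruct ex_last_permanent as (m & Hm & Pm).
  destruct guess_settles as [N1 HN1], ex_settled as [N2 HN2].
  assert (forall N, exists t, N <= t /\ true_stage A At t /\ top u t = m /\ settled t /\
    push_rule u t m = false /\
    (guess u t = true <-> exists x, forall t, x <= t -> growth u t = false)) as HT.
  { intros N. destruct (ex_true_stage At_mono At_lim (max (max N m) (max N1 N2))) as (t & Ht & T).
    exists t. assert (top u t = m) as E by (apply top_true_stage; auto; lia).
    repeat split; auto; try lia.
    - apply HN2. lia.
    (* A push at the true stage [t] would be permanent and later than the last one. *)
    - destruct (push_rule u t m) eqn:F; auto.
      enough (t < m) by lia. apply Hm. split; auto. now rewrite push_eq, E.
    - apply HN1; auto. lia.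
    - apply HN1; auto. lia. }
  destruct (bool_dec (negb (m =? 0) && guess u (pred m)) true) as [C|C].
  - apply andb_true_iff in C as [C0 C]. apply negb_true_iff in C0.
    destruct Pm as [->|Pm]; [discriminate|]. exists (pred m). repeat split; try apply Pm; auto.
    destruct (classic (settled (pred m))) as [|NS]; auto. exfalso.
    (* The values at [pred m] are not final, so [same] fails at late true stages. As nothing is
       pushed, the guess there is true and they are growth stages. *)
    assert (forall N, exists t, N <= t /\ growth u t = true) as Hinf.
    { intros N. destruct (HT N) as (t & L & T & E & S & R & _). exists t. split; auto.
      assert (same u t (pred m) = false) as F.
      { destruct (same u t (pred m)) eqn:F; auto. destruct NS. now apply same_settled in F. }
      unfold push_rule in R. unfold growth. rewrite E, C, F. rewrite C0, C, F in R.
      apply Nat.eqb_neq in C0. destruct (Nat.ltb_spec 0 m); [|lia]. now destruct (guess u t). }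
    destruct (HT 0) as (t & _ & T & E & S & R & D).
    assert (guess u t = true) as Dt.
    { unfold push_rule in R. rewrite C0, C in R. destruct (guess u t); auto.
      cbn [negb andb] in R. destruct (same u t (pred m)) eqn:F; [|discriminate].
      destruct NS. now apply same_settled in F. }
    apply D in Dt as [x Hx]. destruct (Hinf x) as (t' & L' & E').
    now rewrite Hx in E'.
  (* The last permanent push is absent or of the second kind. As nothing is pushed, the guess
     answers infinitely many; it remains to bound the growth stages. *)
  - exfalso.
    destruct (HT 0) as (t & _ & T & E & S & R & D).
    assert (guess u t = false) as Dt.
    { unfold push_rule in R. destruct (m =? 0); auto. destruct (guess u (pred m)); auto.
      now destruct C. }
    enough (exists x, forall t, x <= t -> growth u t = false) as H.
    { apply D in H. congruence. }
    destruct (eventually_forall_lt (fun l t => ~ permanent l -> push u l = true ->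
      valid At l t = false) N2) as [N HN].
    { intros l _. destruct (classic (permanent l)) as [P|NP]; [exists 0; tauto|].
      destruct (classic (push u l = true)) as [P|P]; [|exists 0; tauto].
      destruct (not_true_stage_invalid At_mono At_lim l) as [N HN].
      - intros T'. now apply NP.
      - exists N. auto. }
    (* From [N2] on values are settled, from [N] on impermanent pushes before [N2] are invalid, from
       [m] on the last permanent push is visible. So an outdated push on top could only be [pred m],
       which is not of the first kind. *)
    exists (max (max N N2) m). intros t' Ht'.
    destruct (growth u t') eqn:X; auto. exfalso. unfold growth in X.
    apply andb_true_iff in X as [X X4]. apply andb_true_iff in X as [X X3].
    apply andb_true_iff in X as [X1 X2]. destruct (top u t') as [|l] eqn:F; [discriminate|].
    cbn [pred] in *. apply negb_true_iff in X4.
    destruct (top_S _ _ F) as (Y1 & Y2 & Y3 & Y4).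
    destruct (Nat.le_gt_cases N2 l) as [h|h].
    + assert (same u t' l = true) as Z by (apply same_settled; apply HN2; lia). congruence.
    + destruct (classic (permanent l)) as [P|NP].
      * destruct Pm as [->|Pm]; [apply Hm in P; lia|].
        pose proof (Hm l P).
        destruct (top_ge t' (pred m)) as (l' & F' & Lm); [lia|apply Pm|
          apply (true_stage_valid At_lim); apply Pm|].
        assert (l = pred m) as -> by (rewrite F in F'; injection F' as <-; lia).
        apply C. rewrite X2. destruct m; [lia|]. reflexivity.
      * rewrite HN in Y3; auto; [discriminate|lia].
Qed.

End Verification.

End Construction.

(** * Limit approximations *)

Lemma turing_le_refl O : turing_le O O.
Proof.
  exists (encode Oracle). intros n. rewrite !phi_encode. cbn. tauto.
Qed.

Lemma rec_double O : rec O (fun m => 2 * m).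
Proof.
  apply (rec_ext (fun x => nat_rect (fun _ => nat) 0 (fun _ r => S (S r)) x)).
  - induction x as [|x IH]; cbn in *; [auto|]. rewrite IH. lia.
  - apply (rec_rect (fun _ => 0) (fun x => x) (fun _ _ r => S (S r))); recauto.
Qed.

Lemma turing_le_join_l A B : turing_le A (join A B).
Proof.
  apply recb_chr_iff. apply (recb_ext (fun m => chr (join A B (2 * m)))).
  - intros m. apply eq_true_iff_eq. rewrite !chr_true. unfold join. split.
    + intros [(k & E & H)|(k & E & _)]; [|lia]. now replace m with k by lia.
    + intros H. left. eauto.
  - apply (recb_comp (fun x => chr (join A B x))); [|apply rec_double].
    apply recb_chr_iff, turing_le_refl.
Qed.

Lemma turing_le_join_r A B : turing_le B (join A B).
Proof.
  apply recb_chr_iff. apply (recb_ext (fun m => chr (join A B (S (2 * m))))).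
  - intros m. apply eq_true_iff_eq. rewrite !chr_true. unfold join. split.
    + intros [(k & E & _)|(k & E & H)]; [lia|]. now replace m with k by lia.
    + intros H. right. exists m. split; auto. lia.
  - apply (recb_comp (fun x => chr (join A B x))); [|apply rec_S, rec_double].
    apply recb_chr_iff, turing_le_refl.
Qed.

(** [bmin] guesses the least witness of a Sigma_2 statement. A genuine witness bounds the guesses;
    without one, as in [bmin_unbounded], they tend to infinity. *)
Lemma bmin_bounded (P : nat -> nat -> bool) a : (forall b, P a b = true) ->
  forall t, a < t -> bmin t (fun a => allb t (P a)) <= a.
Proof.
  intros H t Ht. destruct (bmin_spec t (fun a => allb t (P a))) as (_ & _ & Hm).
  destruct (Nat.le_gt_cases (bmin t (fun a => allb t (P a))) a) as [|h]; auto. exfalso.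
  specialize (Hm a h). cbn in Hm.
  assert (allb t (P a) = true) by now apply allb_spec. congruence.
Qed.

Lemma bmin_unbounded (P : nat -> nat -> bool) a : (forall a, exists b, P a b = false) ->
  exists N, forall t, N <= t -> a < bmin t (fun a => allb t (P a)).
Proof.
  intros H.
  destruct (eventually_forall_lt (fun a t => allb t (P a) = false) (S a)) as [N HN].
  { intros i _. destruct (H i) as [b Hb]. exists (S b). intros t Ht.
    destruct (allb t (P i)) eqn:E; auto. rewrite allb_spec in E. now rewrite E in Hb by lia. }
  exists (max N (S a)). intros t Ht.
  destruct (bmin_spec t (fun a => allb t (P a))) as (_ & Hm & _).
  destruct (Nat.le_gt_cases (bmin t (fun a => allb t (P a))) a) as [h|]; auto. exfalso.
  rewrite HN in Hm by lia. discriminate Hm. lia.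
Qed.

(** Shoenfield's limit lemma. [s] guesses a witness for membership, [p] one for non-membership;
    exactly one stays bounded, and the comparison finds it. *)
Lemma limit_lemma X : Delta02 X -> exists Xt, recb2 empty Xt /\
  forall m, exists N, forall t, N <= t -> Xt t m = chr (X m).
Proof.
  intros [(RS & HS & ES) (RP & HP & EP)].
  apply recb_chr_iff in HS, HP.
  set (rs := fun x => chr (RS x)) in HS. set (rp := fun x => chr (RP x)) in HP.
  set (s := fun n t => bmin t (fun a => allb t (fun b => rs ⟨n, ⟨a, b⟩⟩))).
  set (p := fun n t => bmin t (fun a => allb t (fun b => negb (rp ⟨n, ⟨a, b⟩⟩)))).
  exists (fun t n => s n t <=? p n t). split.
  { unfold s, p. recauto. }
  intros m. destruct (classic (X m)) as [h|h].
  - destruct (proj1 (ES m) h) as [a Ha].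
    destruct (bmin_unbounded (fun a b => negb (rp ⟨m, ⟨a, b⟩⟩)) a) as [N HN].
    { intros i. destruct (proj1 (EP m) h i) as [b Hb]. exists b.
      apply negb_false_iff. now apply chr_true. }
    exists (max N (S a)). intros t Ht. rewrite (proj2 (chr_true _) h). apply Nat.leb_le.
    pose proof (HN t ltac:(lia)).
    pose proof (bmin_bounded (fun a b => rs ⟨m, ⟨a, b⟩⟩) a
      (fun b => proj2 (chr_true _) (Ha b)) t ltac:(lia)).
    unfold s, p. lia.
  - assert (exists a, forall b, ~ RP ⟨m, ⟨a, b⟩⟩) as [a Ha].
    { apply NNPP. intros N. apply h, EP. intros a. apply NNPP. intros N'. apply N.
      exists a. intros b Hb. apply N'. eauto. }
    destruct (bmin_unbounded (fun a b => rs ⟨m, ⟨a, b⟩⟩) a) as [N HN].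
    { intros i. apply NNPP. intros N. apply h, ES. exists i. intros b. apply NNPP. intros N'.
      apply N. exists b. now apply chr_false. }
    exists (max N (S a)). intros t Ht. rewrite (proj2 (chr_false _) h). apply Nat.leb_gt.
    pose proof (HN t ltac:(lia)).
    pose proof (bmin_bounded (fun a b => negb (rp ⟨m, ⟨a, b⟩⟩)) a
      (fun b => proj2 (negb_true_iff _) (proj2 (chr_false _) (Ha b))) t ltac:(lia)).
    unfold s, p. lia.
Qed.

(** A computation of [g] has finite use, on which the approximation of [X] settles. [pred] removes
    the successor by which [run] marks a result. *)
Lemma limit_computable_fun X g : Delta02 X -> computes_fun X g ->
  exists G, rec2 empty G /\ forall v, exists N, forall t, N <= t -> G t v = g v.
Proof.
  intros HX [e He]. destruct (limit_lemma X HX) as (Xt & HXt & Hlim).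
  set (q := fun t m => Nat.b2n (Xt t m)).
  assert (rec2 empty q) as Hq by exact HXt.
  exists (fun t v => pred (run (q t) e v t)). split.
  { unfold rec2. apply rec_pred. apply (rec_run empty q); recauto. }
  intros v. destruct (run_complete _ _ _ _ (He v)) as [N HN].
  destruct (eventually_forall_lt (fun m t => Xt t m = chr (X m)) N) as [M HM]; [auto|].
  exists (max N M). intros t Ht. rewrite (HN (q t) t); auto; [|lia].
  intros m Hm. unfold q. rewrite HM by lia.
  split; intros h; [rewrite (proj2 (chr_true _) h) | rewrite (proj2 (chr_false _) h)]; reflexivity.
Qed.

Definition halts (t e x : nat) : bool := 0 <? run (fun _ => 0) e x t.

Lemma recb_halts O : recb3 O halts.
Proof.
  unfold recb3, halts. apply recb_ltb; [recauto|].
  apply (rec_run O (fun _ _ => 0) (fun _ => 0)); recauto.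
Qed.

Ltac recknown ::=
  lazymatch goal with
  | |- rec3 _ look => apply rec_look
  | |- rec2 _ smn => apply rec_smn
  | |- recb _ is_code => apply recb_is_code
  | |- recb3 _ halts => apply recb_halts
  end.

Lemma ltb_0_run q e x n : (0 <? run q e x n) = true <-> exists y, run q e x n = S y.
Proof.
  rewrite Nat.ltb_lt. split; [|intros [y ->]; lia].
  destruct (run q e x n) as [|y]; [lia|]. eauto.
Qed.

Lemma halts_mono t t' e x : t <= t' -> halts t e x = true -> halts t' e x = true.
Proof.
  intros L. unfold halts. rewrite !ltb_0_run. intros [y Hy]. exists y.
  revert Hy. apply run_mono; auto.
Qed.

Lemma halts_lim e x : (exists y, phi empty e x y) <-> exists t, halts t e x = true.
Proof.
  split.
  - intros [y Hy]. destruct (run_complete _ _ _ _ Hy) as [N HN]. exists N.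
    apply ltb_0_run. exists y. apply HN; auto. intros m _. split; [intros []|auto].
  - intros [t Ht]. apply ltb_0_run in Ht as [y Hy]. exists y.
    apply run_sound with (O := empty) in Hy; auto. intros m. split; [discriminate|auto].
Qed.

(** * Approximating the jump of a c.e. set *)

Section JumpApproximation.

Context {A : natset} {At : nat -> nat -> bool}.
Hypothesis At_mono : forall m t t', t <= t' -> At t m = true -> At t' m = true.
Hypothesis At_lim : forall m, A m <-> exists t, At t m = true.

(** The answer 2 blocks the machine, so a halting computation has queried only numbers below
    [tlen At t]. *)
Definition answer (t m : nat) : nat := if m <? tlen At t then Nat.b2n (At t m) else 2.

Definition jump_at (t k : nat) : bool := 0 <? run (answer t) k k t.

Lemma recb_jump_at O : recb2 O At -> recb2 O jump_at.
Proof.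
  intros H. pose proof (rec_tlen _ _ H).
  assert (rec2 O answer) by (unfold answer; recauto).
  unfold recb2, jump_at. apply recb_ltb; [recauto|]. apply (rec_run O answer); recauto.
Qed.

(** Validity makes the answers at [t] extend those at [l], so [run_mono] applies. *)
Lemma jump_at_mono l t k : l <= t -> valid At l t = true -> jump_at l k = true -> jump_at t k = true.
Proof.
  intros L V. unfold jump_at. rewrite !ltb_0_run. intros [y Hy]. exists y.
  revert Hy. apply run_mono; auto. intros m. unfold answer.
  pose proof (tlen_valid At_mono l t L V). rewrite valid_spec in V.
  destruct (Nat.ltb_spec m (tlen At l)) as [h|h]; [|lia].
  destruct (Nat.ltb_spec m (tlen At t)) as [h'|h']; [|lia]. intros _. f_equal.
  apply eq_true_iff_eq. split; auto. now apply At_mono.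
Qed.

Lemma jump_at_sound t k : true_stage A At t -> jump_at t k = true -> jump A k.
Proof.
  intros T H. apply ltb_0_run in H as [y Hy]. exists y. apply run_sound with (O := A) in Hy; auto.
  intros m. unfold answer. destruct (Nat.ltb_spec m (tlen At t)) as [h|h]; [|split; discriminate].
  destruct (At t m) eqn:E; cbn; split; try discriminate.
  - intros _. apply At_lim. eauto.
  - intros _ HA. apply T in HA; auto. congruence.
Qed.

Lemma jump_at_lim k : jump A k ->
  exists N, forall t, N <= t -> true_stage A At t -> jump_at t k = true.
Proof.
  intros [y Hy]. apply run_complete in Hy as [N HN].
  destruct (tlen_lim At_mono At_lim N) as [M HM].
  exists (max N M). intros t Ht T. apply ltb_0_run. exists y. apply HN; [|lia].
  intros m Hm. specialize (HM t ltac:(lia)). unfold answer.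
  destruct (Nat.ltb_spec m (tlen At t)); [|lia]. split; intros h.
  - rewrite T; auto.
  - destruct (At t m) eqn:E; auto. destruct h. apply At_lim. eauto.
Qed.

End JumpApproximation.

(** With the halting problem as oracle, search for an [x] whose program diverges. That program will
    look for a growth stage from [x] on, so membership in the double jump will mean finitely many
    growth stages. *)
Lemma not_total_code : exists q, forall u,
  jump (jump empty) (smn q u) <->
  exists x, ~ jump empty (smn (unpair_l u) ⟨1, ⟨unpair_r u, x⟩⟩).
Proof.
  assert (recb (jump empty) (fun x => chr (jump empty x))) as HJ
    by apply recb_chr_iff, turing_le_refl.
  destruct (search_code (jump empty) (fun z => negb ((fun x => chr (jump empty x))
    ((fun u => smn (unpair_l u) ⟨1, ⟨unpair_r u, unpair_r z⟩⟩) (unpair_l (unpair_l z)))))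
    (fun _ => 0)) as [c Hc].
  { apply recb_negb. apply (recb_comp (fun x => chr (jump empty x))); auto. recauto. }
  { recauto. }
  exists (encode c). intros u. unfold jump at 1.
  (* [jump] applies a program to its own index [r]; the test does not look at this input. *)
  set (r := smn (encode c) u) at 2. destruct (Hc ⟨u, r⟩) as [H1 H2]. split.
  - intros [y Hy]. apply phi_smn in Hy. apply H1 in Hy as (x & Hx & _). exists x.
    unp in *. apply negb_true_iff in Hx. now apply chr_false in Hx.
  - intros [x Hx]. destruct (H2 x) as [y Hy].
    + unp. apply negb_true_iff. now apply chr_false.
    + exists y. now apply phi_smn.
Qed.

(** * The reduction *)

Section Recursion.

Variables (At U : nat -> nat -> bool) (G : nat -> nat -> nat) (tb : nat -> nat) (q : nat).
Hypotheses (HAt : recb2 empty At) (HU : recb2 empty U) (HG : rec2 empty G) (Htb : rec empty tb).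

(* The recursion theorem: programs [smn p ⟨0, ⟨n, j⟩⟩] and [smn p ⟨1, ⟨n, x⟩⟩] run the
   construction that mentions [p] itself. *)
Lemma self_referential_index : exists p,
  (forall n j w, let u := ⟨p, n⟩ in
    (forall r, phi empty (pos u j) w r -> exists t l,
       (halts t n n && (l <? t) && push At U G tb q u l && valid At l t
        && guess U tb q u l && (label U tb q u l =? j)) = true /\ r = G l (pos u j)) /\
    (forall t l, (halts t n n && (l <? t) && push At U G tb q u l && valid At l t
        && guess U tb q u l && (label U tb q u l =? j)) = true ->
       exists r, phi empty (pos u j) w r)) /\
  (forall n x, jump empty (smn p ⟨1, ⟨n, x⟩⟩) <->
     exists t, x <= t /\ growth At U G tb q ⟨p, n⟩ t = true).
Proof.
  pose proof (recb_push At U G tb q HAt HU HG Htb).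
  pose proof (recb_growth At U G tb q HAt HU HG Htb).
  pose proof (recb_guess U tb q HU Htb).
  pose proof (rec_label U tb q HU Htb).
  pose proof (rec_pos (O := empty)).
  pose proof (recb_valid _ _ HAt).
  (* Here [y] is a pair of a halting stage and a push. [smn v v] stands for the index of the program
     being defined. *)
  set (kill := fun v n i y => let u := ⟨smn v v, n⟩ in
    halts (unpair_l y) n n && (unpair_r y <? unpair_l y) && push At U G tb q u (unpair_r y)
    && valid At (unpair_r y) (unpair_l y)
    && guess U tb q u (unpair_r y) && (label U tb q u (unpair_r y) =? i)).
  set (grow := fun v n i y => (i <=? y) && growth At U G tb q ⟨smn v v, n⟩ y).
  set (cond := fun v a y => if unpair_l a =? 0
    then kill v (unpair_l (unpair_r a)) (unpair_r (unpair_r a)) y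
    else grow v (unpair_l (unpair_r a)) (unpair_r (unpair_r a)) y).
  set (out := fun v a y =>
    G (unpair_r y) (pos ⟨smn v v, unpair_l (unpair_r a)⟩ (unpair_r (unpair_r a)))).
  destruct (search_code empty
    (fun z => cond (unpair_l (unpair_l z)) (unpair_l (unpair_r (unpair_l z))) (unpair_r z))
    (fun z => out (unpair_l (unpair_l z)) (unpair_l (unpair_r (unpair_l z))) (unpair_r z)))
    as [c Hc].
  { unfold cond, kill, grow. cbv zeta. recauto. }
  { unfold out. recauto. }
  (* Self-application: for [v = encode c] the expression [smn v v] is [p]. *)
  set (p := smn (encode c) (encode c)).
  assert (forall a w r, phi empty (smn p a) w r <-> eval empty c ⟨encode c, ⟨a, w⟩⟩ r) as Hp.
  { intros a w r. unfold p. rewrite smn_code, phi_smn, <- phi_encode, <- smn_code. apply phi_smn. }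
  exists p. split.
  - intros n j w. cbv zeta.
    assert (pos ⟨p, n⟩ j = smn p ⟨0, ⟨n, j⟩⟩) as Ep by (unfold pos; now unp).
    destruct (Hc ⟨encode c, ⟨⟨0, ⟨n, j⟩⟩, w⟩⟩) as [Hout Hhalt]. split.
    + intros r Hr. rewrite Ep in Hr. apply Hp, Hout in Hr as (y & Hy & ->). unp in *.
      exists (unpair_l y), (unpair_r y). unfold cond, kill in Hy. unp in *.
      split; [exact Hy|]. unfold out. now unp.
    + intros t l Htl. destruct (Hhalt ⟨t, l⟩) as [r Hr].
      * unp. unfold cond, kill. cbv zeta. unp. exact Htl.
      * exists r. rewrite Ep. now apply Hp.
  - intros n x. unfold jump. set (w := smn p _) at 2.
    destruct (Hc ⟨encode c, ⟨⟨1, ⟨n, x⟩⟩, w⟩⟩) as [Hout Hhalt]. split.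
    + intros [r Hr]. apply Hp, Hout in Hr as (y & Hy & _). unp in *.
      unfold cond, grow in Hy. unp in *. apply andb_true_iff in Hy as [Hx Hy].
      apply Nat.leb_le in Hx. eauto.
    + intros (t & Hx & Ht). destruct (Hhalt t) as [r Hr].
      * unp. unfold cond, grow. unp. apply andb_true_iff. split; auto. now apply Nat.leb_le.
      * exists r. now apply Hp.
Qed.

End Recursion.

Theorem mainTheorem9 (A X : nat -> Prop)
    (hAce : ce A) (hAsh : superhigh A)
    (hXdelta : Delta02 X) (hXdnr : DNR X) :
  turing_le (jump empty) (join A X).
Proof.
  destruct hXdnr as (g & Hg & Hdnr).
  destruct (limit_computable_fun X g hXdelta Hg) as (G & HG & G_lim).
  destruct hAce as [eA HeA]. set (At := fun t m => halts t eA m).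
  assert (forall m t t', t <= t' -> At t m = true -> At t' m = true) as At_mono
    by (intros m t t'; apply halts_mono).
  assert (forall m, A m <-> exists t, At t m = true) as At_lim
    by (intros m; rewrite HeA; apply halts_lim).
  assert (forall O, recb2 O At) as HAt by (intros O; unfold At; recauto).
  destruct hAsh as (tt & Htt & Hsat). apply computes_fun_rec in Htt.
  set (tb := fun n => encode_bform (tt n)) in Htt.
  set (U := @jump_at At).
  assert (forall O, recb2 O U) as HU by (intros O; now apply recb_jump_at).
  destruct not_total_code as [q Hq].
  destruct (self_referential_index At U G tb q (HAt _) (HU _) HG Htt) as (p & Hkill & Hgrow).
  (* The circle closes: the table for [smn q ⟨p, n⟩] answers the question about the construction
     that uses it. *)
  assert (forall n, sat (jump A) (tt (smn q ⟨p, n⟩)) <->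
    exists x, forall t, x <= t -> growth At U G tb q ⟨p, n⟩ t = false) as Hcorrect.
  { intros n. rewrite <- Hsat, Hq. unp. split; intros [x Hx]; exists x.
    - intros t Ht. apply not_true_is_false. intros E. apply Hx, Hgrow. eauto.
    - intros H. apply Hgrow in H as (t & Ht & E). rewrite Hx in E; [discriminate|auto]. }
  assert (rec2 (join A X) G) as HG' by (apply rec_trans with empty; auto using turing_le_empty).
  assert (rec (join A X) tb) as Htt' by (apply rec_trans with empty; auto using turing_le_empty).
  assert (rec (join A X) g) as Hg'
    by (apply rec_trans with X; [apply turing_le_join_r | now apply computes_fun_rec]).
  set (chrA := fun m => chr (A m)).
  assert (recb (join A X) chrA) as HA by apply recb_chr_iff, turing_le_join_l.
  pose proof (HAt (join A X)).
  pose proof (recb_push At U G tb q (HAt (join A X)) (HU _) HG' Htt').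
  pose proof (recb_guess U tb q (HU (join A X)) Htt').
  pose proof (rec_label U tb q (HU (join A X)) Htt').
  pose proof (rec_pos (O := join A X)).
  pose proof (rec_tlen _ _ (HAt (join A X))).
  (* Decidable from [A] and [X]: a push of the first kind at a true stage whose value at its own
     reserved point is that of [g]. *)
  set (good := fun n s => let u := ⟨p, n⟩ in
    push At U G tb q u s && guess U tb q u s
    && allb (tlen At s) (fun m => implb (chrA m) (At s m))
    && (g (pos u (label U tb q u s)) =? G s (pos u (label U tb q u s)))).
  (* The search ends when [n] is seen to halt or a good stage appears; the output tells whether [n]
     has halted by then. *)
  destruct (search_code (join A X)
    (fun z => halts (unpair_r z) (unpair_l z) (unpair_l z) || good (unpair_l z) (unpair_r z))
    (fun z => Nat.b2n (halts (unpair_r z) (unpair_l z) (unpair_l z)))) as [c Hc].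
  { unfold good. cbv zeta. recauto. }
  { recauto. }
  exists (encode c). intros n. rewrite !phi_encode.
  destruct (Hc n) as [Hout Hhalt]. set (u := ⟨p, n⟩) in *.
  assert (forall l t k, l <= t -> valid At l t = true -> U l k = true -> U t k = true) as U_mono
    by (intros l t k; now apply jump_at_mono).
  assert (table tb q u = encode_bform (tt (smn q u))) as Htable by reflexivity.
  assert (exists s, good n s = true) as [s0 Hs0].
  { destruct (ex_settled_permanent At U G tb q At_mono U_mono Htable At_lim
      (jump_at_sound At_lim) (jump_at_lim At_mono At_lim) G_lim (Hcorrect n))
      as (s & [P T] & D & St).
    exists s. unfold good. cbv zeta. fold u. rewrite P, D. cbn [andb].
    apply andb_true_iff. split.
    - apply allb_spec. intros m Hm. destruct (chrA m) eqn:E; auto.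
      cbn. apply T; auto. now apply chr_true.
    - apply Nat.eqb_eq. symmetry. apply St. apply label_bound. }
  destruct (Hhalt s0) as [r Hr]; [unp; rewrite Hs0; apply orb_true_r|].
  destruct (Hout r Hr) as (s & Hs & ->). unp in *.
  destruct (halts s n n) eqn:E.
  - split; [auto|]. intros N. destruct N. apply halts_lim. eauto.
  (* The output 0 is wrong only if [n] halts after the good stage [s]; then the program at the point
     reserved for [s] contradicts DNR. *)
  - split; [|auto]. intros J. exfalso. cbn [orb] in Hs.
    unfold good in Hs. cbv zeta in Hs. fold u in Hs.
    apply andb_true_iff in Hs as [Hs Hval]. apply andb_true_iff in Hs as [Hs Htrue].
    apply andb_true_iff in Hs as [P D]. apply Nat.eqb_eq in Hval.
    assert (true_stage A At s) as T.
    { intros m Hm HAm. rewrite allb_spec in Htrue. specialize (Htrue m Hm).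
      now rewrite (proj2 (chr_true _) HAm : chrA m = true) in Htrue. }
    assert (forall t, halts t n n = true -> s < t) as Hlate.
    { intros t Ht. destruct (Nat.le_gt_cases t s) as [h|]; auto.
      now rewrite (halts_mono _ _ _ _ h Ht) in E. }
    apply halts_lim in J as [t Ht].
    set (j := label U tb q u s) in *.
    destruct (Hkill n j (pos u j)) as [K1 K2]. fold u in K1, K2.
    destruct (K2 t s) as [r' Hr'].
    { rewrite Ht, P, D, (true_stage_valid At_lim s t T). fold j. rewrite Nat.eqb_refl.
      rewrite (proj2 (Nat.ltb_lt _ _) (Hlate t Ht)). reflexivity. }
    (* The program may have found another pair [t'], [l]. But the true stage [s] is valid at [t'],
       so equal labels force [l = s]. *)
    destruct (K1 r' Hr') as (t' & l & Hl & ->).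
    repeat (apply andb_true_iff in Hl as [Hl ?]).
    apply (Hdnr _ _ Hr'). rewrite Hval. f_equal.
    apply (label_inj At U G tb q At_mono U_mono Htable) with (t := t'); auto.
    + now apply Nat.ltb_lt.
    + now apply (true_stage_valid At_lim).
    + symmetry. now apply Nat.eqb_eq.
Qed.
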